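(* Let $E\supseteq F$ be fields, $M$ a Lie $E$-algebra of maximal class and $L=\bigoplus_{i\ge 1}L_i$ the Lie $F$-algebra generated by a finite-dimensional $F$-subspace $L_1$ of $M_1$ such that $EL_1=M_1$. Assume that the $2$-step field $\mathcal{K}$ of $L$ is a finite extension of $F$. Then one of the following holds: (1) $\dim_{\mathcal{K}}\mathcal{K}L_1=2$ and $L$ is ideally $r$-constrained for some positive integer $r$; (2) $\dim_{\mathcal{K}}\mathcal{K}L_1>2$ and $L$ is not just infinite.
   Context: If $X$ is a subset of a module over a ring $R$, $RX$ denotes the $R$-submodule generated by $X$. For additive subgroups (or subsets) $X,Y$ of a Lie algebra, $[X,Y]$ is the additive subgroup generated by all $[x,y]$, $x\in X$, $y\in Y$. Lie algebras are graded, $L=\bigoplus_{i\ge1}L_i$, generated by the first homogeneous component $L_1$ (so $L_i=[L_{i-1},L_1]$ for $i\ge 2$), with $L_i\neq 0$ for all $i$. A Lie algebra $M=\bigoplus_{i\ge1}M_i$ over a field $E$ is of maximal class if $\dim_E M_1=2$ and $\dim_E M_i=1$ for all $i\ge 2$. For $i\ge2$ its $2$-step centraliser is $C_i=\{x\in M_1 : [M_i,x]=0\}$, a one-dimensional $E$-subspace of $M_1$. The Lie $F$-algebra generated by an $F$-subspace $L_1\subseteq M_1$ is $L=\bigoplus_{i\ge 1}L_i$ with $L_i=[L_{i-1},L_1]\subseteq M_i$ for $i\ge2$. Since $EL_1=M_1$, $L_1\not\subseteq C_i$ for every $i\ge 2$. For $i\ge 2$, choose any $E$-linear map $\phi_i\colon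 M_1\to E$ with $\ker\phi_i=C_i$ and $1\in\phi_i(L_1)$, and let $F_i$ be the subfield of $E$ generated by $\phi_i(L_1)$; this subfield contains $F$ and does not depend on the choice of $\phi_i$. The $2$-step field $\mathcal{K}$ of $L$ is the subfield of $E$ generated by all the $F_i$, $i\ge2$. For a positive integer $r$, a Lie algebra $L=\bigoplus_{i\ge1}L_i$ is ideally $r$-constrained if for every non-zero graded ideal $I$ of $L$ there is an integer $i\ge 1$ such that $L^i\supseteq I\supseteq L^{i+r}$, where $L^k=\bigoplus_{j\ge k}L_j$. An (infinite-dimensional) Lie algebra is just infinite if each of its non-zero graded ideals has finite codimension. *)

(* Defs.v *)
From HB Require Import structures.
From mathcomp Require Import all_boot all_algebra.
From mathcomp Require Import boolp classical_sets.

Set Implicit Arguments.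
Unset Strict Implicit.
Unset Printing Implicit Defensive.

Import GRing.Theory.
Local Open Scope classical_set_scope.
Local Open Scope ring_scope.

HB.mixin Record Lmodule_isLieAlgebra (R : fieldType) V of GRing.Lmodule R V := {
  lie : V -> V -> V;
  lie_linearl : forall y : V, linear (fun x => lie x y);
  lie_linearr : forall x : V, linear (lie x);
  liexx : forall x : V, lie x x = 0;
  lie_jacobi : forall x y z : V,
    lie x (lie y z) + lie y (lie z x) + lie z (lie x y) = 0
}.

#[short(type="lieAlgType")]
HB.structure Definition LieAlgebra (R : fieldType) :=
  {V of Lmodule_isLieAlgebra R V & GRing.Lmodule R V}.

(* The fields F and K of the theory are subfields of an ambient field E of
   possibly infinite degree, and vector spaces over them are subsets of
   E-modules.  They are therefore classical sets, and linear algebra over a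
   subfield K is relative to K. *)
Section Subfields.
Variable E : fieldType.
Implicit Types (K F : set E) (V : lmodType E).

Definition is_subfield K := divring_closed [in K].

Definition subfield_gen (X : set E) : set E := smallest is_subfield X.

Definition is_subspace K V (W : set V) :=
  zmod_closed [in W] /\ forall a x, K a -> W x -> W (a *: x).

Definition kspan K V (X : set V) : set V := smallest (@is_subspace K V) X.

Definition kfree K V n (v : 'I_n -> V) :=
  forall c : 'I_n -> E, (forall i, K (c i)) ->
    \sum_i c i *: v i = 0 -> forall i, c i = 0.

Definition has_dim K V (W : set V) (n : nat) :=
  exists2 v : 'I_n -> V, kfree K v & W = kspan K (range v).

Definition fin_dim K V (W : set V) := exists n, has_dim K W n.

(* The quotient of A by I is spanned by finitely many cosets. *)
Definition fin_codim K V (A I : set V) :=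
  exists n (v : 'I_n -> V),
    (forall i, A (v i)) /\ A = kspan K (I `|` range v).

Definition finite_extension F K := F `<=` K /\ fin_dim F (K : set E^o).

End Subfields.

(* Families of homogeneous components are indexed by nat, but only the indices
   i >= 1 are meaningful: the value at 0 is never used. *)
Section Graded.
Variables (E : fieldType) (M : lieAlgType E).
Implicit Types (K F : set E) (A : nat -> set M) (X Y I : set M).

Definition lie_set X Y : set M :=
  smallest (fun Z : set M => zmod_closed [in Z])
    [set z | exists x y, [/\ X x, Y y & z = lie x y]].

Definition tail A (k : nat) : set M :=
  [set x | exists n (f : nat -> M),
     (forall i, (k <= i)%N -> A i (f i)) /\ x = \sum_(k <= i < n) f i].

Definition direct A :=
  forall n (f : nat -> M), (forall i, (1 <= i)%N -> A i (f i)) ->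
    \sum_(1 <= i < n) f i = 0 -> forall i, (1 <= i < n)%N -> f i = 0.

Definition maximal_class A :=
  [/\ tail A 1 = setT /\ direct A,
      (forall i, (1 <= i)%N -> is_subspace setT (A i)),
      (forall i j, (1 <= i)%N -> (1 <= j)%N ->
         lie_set (A i) (A j) `<=` A (i + j)%N),
      (forall i, (2 <= i)%N -> A i = lie_set (A i.-1) (A 1%N))
    & has_dim setT (A 1%N) 2 /\ forall i, (2 <= i)%N -> has_dim setT (A i) 1].

(* The homogeneous components of the Lie ring generated by L1. *)
Fixpoint lie_comp (L1 : set M) (i : nat) : set M :=
  match i with
  | 0 => [set 0]
  | 1 => L1
  | j.+1 => lie_set (lie_comp L1 j) L1
  end.

Definition graded_ideal F A I :=
  [/\ is_subspace F I, I `<=` tail A 1, lie_set I (tail A 1) `<=` I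
    & I = tail (fun i => I `&` A i) 1].

Definition ideally_constrained F A (r : nat) :=
  forall I, graded_ideal F A I -> I <> [set 0] ->
    exists i, [/\ (1 <= i)%N, I `<=` tail A i & tail A (i + r) `<=` I].

Definition just_infinite F A :=
  ~ fin_dim F (tail A 1) /\
  forall I, graded_ideal F A I -> I <> [set 0] -> fin_codim F (tail A 1) I.

Definition centraliser A (i : nat) : set M :=
  [set x | A 1%N x /\ forall y, A i y -> lie y x = 0].

(* E-linear maps A 1 -> E with kernel the i-th 2-step centraliser, normalised
   on L1; their values outside A 1 are irrelevant. *)
Definition two_step_map A (L1 : set M) (i : nat) : set (M -> E) :=
  [set phi | [/\ forall a x y, A 1%N x -> A 1%N y ->
                   phi (a *: x + y) = a * phi x + phi y,
                 centraliser A i = [set x | A 1%N x /\ phi x = 0]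
               & (phi @` L1) 1]].

(* The field generated by the image of L1 does not depend on the choice of a
   map, which is left to xget. *)
Definition two_step_subfield A (L1 : set M) (i : nat) : set E :=
  subfield_gen (xget (fun=> 0) (two_step_map A L1 i) @` L1).

Definition two_step_field A (L1 : set M) : set E :=
  subfield_gen (\bigcup_(i in [set i | (2 <= i)%N]) two_step_subfield A L1 i).

End Graded.

(* Main.v *)
Require Import Defs.
From mathcomp Require Import all_boot all_algebra.
From mathcomp Require Import boolp classical_sets.
From mathcomp Require Import ring zify.
Import GRing.Theory.
Local Open Scope classical_set_scope.
Local Open Scope ring_scope.
Set Implicit Arguments.
Unset Strict Implicit.

(** For [i >= 2] the component [M i] is a line, and generators [e i] can be
    chosen with [[e i, x] = phi i x e i.+1] ([adapted_generators]).  In these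
    coordinates, bracketing with [L1] multiplies an [F]-subspace of [E] by
    [V i = phi i (L1)], a subspace of the two-step field [K] that contains [1].
    Both alternatives follow from one fact: for some [r] and all [i >= 2] the
    product [V i * ... * V (i + r - 1)] spans [K]
    ([window_prod_eventually_full], [brackets_fill_lines]).

    This fact rests on the recurrence of the two-step centralisers: each [C j]
    reappears in every window of some fixed length ([centraliser_recurs]).  In
    characteristic [p], let [y] span [C j] and let [q] be a power of [p] with
    [q >= j].  Then [(ad y) ^ q] is a derivation, and it kills the generators
    in degree 1 because already [(ad y) ^ j] does; so it is zero, and among any
    [q] consecutive centralisers one contains [y].  In characteristic 0 a
    computation with Jacobi's identity shows that all the centralisers
    coincide.  Since [V i] depends only on [C i], the [V j] recur as well.
    Finitely many of them generate the finite extension [K]; a product over a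
    window meeting all of these either grows in dimension or is stable under
    [K], and the degree of [K] over [F] bounds the growth.

    If [K L1] has dimension 2, a [K]-basis of it gives a coordinate [e 2] for
    which all [L i] lie in [K e i].  An ideal with a non-zero element in
    degree [i >= 2] then contains [K e j], hence [L j], for all [j >= i + r];
    the case [i = 1] costs one more step.  If the dimension is larger, take
    [e 2 = [x, y]] with [x] and [y] in [L1].  Some [b] outside [K] satisfies
    [b e i \in L i] for all [i >= 2], whereas [K e i] lies in [L i] for large
    [i].  The sum of these lines [K e i] is an ideal of infinite codimension. *)

(** * Linear algebra relative to a subfield *)

Section Subfield.
Variables (E : fieldType) (K : set E).

Lemma is_subfieldP : is_subfield K <->
  [/\ K 1, forall x y, K x -> K y -> K (x - y)
    & forall x y, K x -> K y -> K (x / y)].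
Proof.
split=> [[h1 hB hD]|[h1 hB hD]].
  split; first by move: h1; rewrite inE.
    by move=> x y Kx Ky; have := hB x y; rewrite !inE; apply.
  by move=> x y Kx Ky; have := hD x y; rewrite !inE; apply.
split; first by rewrite inE.
  by move=> x y; rewrite !inE; apply: hB.
by move=> x y; rewrite !inE; apply: hD.
Qed.

Hypothesis hK : is_subfield K.

Lemma subfield1 : K 1.
Proof. by have /is_subfieldP[] := hK. Qed.

Lemma subfieldB x y : K x -> K y -> K (x - y).
Proof. by have /is_subfieldP[_ hB _] := hK; apply: hB. Qed.

Lemma subfield0 : K 0.
Proof. by rewrite -(subrr 1); apply: subfieldB; apply: subfield1. Qed.

Lemma subfieldN x : K x -> K (- x).
Proof. by move=> Kx; rewrite -[- x]add0r; apply: subfieldB => //; apply: subfield0. Qed.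

Lemma subfieldD x y : K x -> K y -> K (x + y).
Proof. by move=> Kx Ky; rewrite -[y]opprK; apply: subfieldB => //; apply: subfieldN. Qed.

Lemma subfield_div x y : K x -> K y -> K (x / y).
Proof. by have /is_subfieldP[_ _ hD] := hK; apply: hD. Qed.

Lemma subfieldV x : K x -> K x^-1.
Proof.
by move=> Kx; rewrite -[x^-1]mul1r; apply: subfield_div => //; apply: subfield1.
Qed.

Lemma subfieldM x y : K x -> K y -> K (x * y).
Proof.
by move=> Kx Ky; rewrite -[y]invrK; apply: subfield_div => //; apply: subfieldV.
Qed.

Lemma subfield_sum n (c : 'I_n -> E) : (forall i, K (c i)) -> K (\sum_i c i).
Proof.
by move=> Kc; apply: (big_ind K) => // [|x y]; [apply: subfield0 | apply: subfieldD].
Qed.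

End Subfield.

Lemma subfield_gen_subfield (E : fieldType) (X : set E) :
  is_subfield (subfield_gen X).
Proof.
apply/is_subfieldP; split.
- by move=> A [hA _]; apply: subfield1.
- by move=> x y Xx Xy A hA; apply: (subfieldB hA.1); [apply: Xx | apply: Xy].
- by move=> x y Xx Xy A hA; apply: (subfield_div hA.1); [apply: Xx | apply: Xy].
Qed.

Section Subspace.
Variables (E : fieldType) (K : set E) (V : lmodType E).
Implicit Types (W X : set V).

Lemma is_subspaceP W : is_subspace K W <->
  [/\ W 0, forall x y, W x -> W y -> W (x - y)
    & forall a x, K a -> W x -> W (a *: x)].
Proof.
split=> [[[h0 hB] hZ]|[h0 hB hZ]].
  split=> //; first by move: h0; rewrite inE.
  by move=> x y Wx Wy; have := hB x y; rewrite !inE; apply.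
split=> //; split; first by rewrite inE.
by move=> x y; rewrite !inE; apply: hB.
Qed.

Section Closure.
Variable W : set V.
Hypothesis hW : is_subspace K W.

Lemma subspace0 : W 0.
Proof. by have /is_subspaceP[] := hW. Qed.

Lemma subspaceB x y : W x -> W y -> W (x - y).
Proof. by have /is_subspaceP[_ hB _] := hW; apply: hB. Qed.

Lemma subspaceZ a x : K a -> W x -> W (a *: x).
Proof. by have [_ hZ] := hW; apply: hZ. Qed.

Lemma subspaceN x : W x -> W (- x).
Proof. by move=> Wx; rewrite -[- x]add0r; apply: subspaceB => //; apply: subspace0. Qed.

Lemma subspaceD x y : W x -> W y -> W (x + y).
Proof. by move=> Wx Wy; rewrite -[y]opprK; apply: subspaceB => //; apply: subspaceN. Qed.

Lemma subspace_sum (I : Type) (r : seq I) (P : pred I) (f : I -> V) :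
  (forall i, P i -> W (f i)) -> W (\sum_(i <- r | P i) f i).
Proof.
by move=> Wf; apply: (big_ind W) => // [|x y]; [apply: subspace0 | apply: subspaceD].
Qed.

End Closure.

Lemma kspan_subspace X : is_subspace K (kspan K X).
Proof.
apply/is_subspaceP; split.
- by move=> A [hA _]; apply: (subspace0 hA).
- by move=> x y Xx Xy A hA; apply: (subspaceB hA.1); [apply: Xx | apply: Xy].
- by move=> a x Ka Xx A hA; apply: (subspaceZ hA.1) => //; apply: Xx.
Qed.

Lemma sub_kspan X : X `<=` kspan K X.
Proof. exact: sub_gen_smallest. Qed.

Lemma kspan_sub X W : is_subspace K W -> X `<=` W -> kspan K X `<=` W.
Proof. by move=> hW; apply: smallest_sub. Qed.

Lemma kspan_rangeP n (v : 'I_n -> V) z : is_subfield K ->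
  kspan K (range v) z <->
  exists2 c : 'I_n -> E, (forall i, K (c i)) & z = \sum_i c i *: v i.
Proof.
move=> hK; split=> [|[c Kc ->]]; last first.
  apply: (subspace_sum (kspan_subspace _)) => i _.
  by apply: (subspaceZ (kspan_subspace _)) => //; apply: sub_kspan; exists i.
apply: (@kspan_sub _ [set z | exists2 c : 'I_n -> E, (forall i, K (c i))
                                & z = \sum_i c i *: v i]).
  apply/is_subspaceP; split.
  - exists (fun=> 0); first by move=> i; apply: subfield0.
    by rewrite big1 // => i _; rewrite scale0r.
  - move=> _ _ [c Kc ->] [d Kd ->]; exists (fun i => c i - d i).
      by move=> i; apply: subfieldB.
    by rewrite -sumrB; apply: eq_bigr => i _; rewrite scalerBl.
  - move=> a _ Ka [c Kc ->]; exists (fun i => a * c i).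
      by move=> i; apply: subfieldM.
    by rewrite scaler_sumr; apply: eq_bigr => i _; rewrite scalerA.
move=> _ [i _ <-]; exists (fun j => (j == i)%:R).
  by move=> j; case: eqP => _; [apply: subfield1 | apply: subfield0].
rewrite (bigD1 i) //= eqxx scale1r big1 ?addr0 // => j /negPf ->.
by rewrite scale0r.
Qed.

End Subspace.

(** Gaussian elimination: the last equation expresses one unknown through the
    others, which leaves one equation and one unknown less. *)
Lemma subfield_kernel (E : fieldType) (F : set E) (hF : is_subfield F) d
    (a : 'I_d.+1 -> 'I_d -> E) : (forall s i, F (a s i)) ->
  exists c : 'I_d.+1 -> E, [/\ forall s, F (c s), exists s, c s != 0
    & forall i, \sum_s c s * a s i = 0].
Proof.
elim: d a => [|d IH] a Fa.
  exists (fun=> 1); split=> [s||[]//]; first exact: subfield1.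
  by exists ord0; rewrite oner_neq0.
have [[p ap]|a0] := pselect (exists p, a p ord_max != 0).
  have Fq := Fa p ord_max; move: ap Fq; set q := a p _ => ap Fq.
  have [|c [Fc [s cs] c0]] := IH (fun s i => a (lift p s) (lift ord_max i)
      - a (lift p s) ord_max / q * a p (lift ord_max i)).
    move=> s i; apply: (subfieldB hF) => //; apply: (subfieldM hF) => //.
    by apply: (subfield_div hF).
  pose b := - \sum_s c s * (a (lift p s) ord_max / q).
  exists (fun t => if unlift p t is Some s then c s else b); split.
  - move=> t; case: unliftP => [s' _|_] //.
    apply/(subfieldN hF)/(subfield_sum hF) => s'; apply: (subfieldM hF) => //.
    by apply: (subfield_div hF).
  - by exists (lift p s); rewrite liftK.
  - have sumE i : \sum_t (if unlift p t is Some s then c s else b) * a t i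
      = b * a p i + \sum_s c s * a (lift p s) i.
      rewrite (bigD1_ord p) //= unlift_none; congr (_ + _).
      by apply: eq_bigr => j _; rewrite liftK.
    move=> i; rewrite sumE /b mulNr mulr_suml addrC -sumrB.
    case: (unliftP ord_max i) => [j ->|->].
      by rewrite -[RHS](c0 j); apply: eq_bigr => s' _; rewrite mulrBr !mulrA.
    by rewrite big1 // => s' _; rewrite -/q -mulrA divfK // subrr.
have {}a0 p : a p ord_max = 0.
  by apply/eqP; apply: contra_notT a0 => ap; exists p.
have [c [Fc [s cs] c0]] := IH (fun s i => a (lift ord_max s) (lift ord_max i))
  (fun _ _ => Fa _ _).
exists (fun t => if unlift ord_max t is Some s then c s else 0); split.
- by move=> t; case: unliftP => [s' _|_] //; apply: subfield0.
- by exists (lift ord_max s); rewrite liftK.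
- move=> i; rewrite (bigD1_ord ord_max) //= unlift_none mul0r add0r.
  under eq_bigr => s' _ do rewrite liftK.
  case: (unliftP ord_max i) => [j ->|->]; first exact: c0.
  by rewrite big1 // => s' _; rewrite a0 mulr0.
Qed.

(** Ascending chains in a space of dimension [d] pause within [d] steps:
    otherwise choosing a new vector at each step gives [d + 1] vectors, and the
    last vector entering a linear relation between them is not new. *)
Lemma subspace_chain_pause (E : fieldType) (F : set E) (V : lmodType E) d
    (v : 'I_d -> V) (S : nat -> set V) :
  is_subfield F -> (forall s, is_subspace F (S s)) ->
  (forall s, S s `<=` S s.+1) -> (forall s, S s `<=` kspan F (range v)) ->
  exists2 s, (s <= d)%N & S s.+1 `<=` S s.
Proof.
move=> hF hS incS Sv; apply: contrapT => noS.
have new (s : 'I_d.+1) : exists w, S s.+1 w /\ ~ S s w.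
  apply: contrapT => no; apply: noS; exists s; first by rewrite -ltnS.
  by move=> w Sw; apply: contrapT => nSw; apply: no; exists w.
have [w hw] := choice new.
have coord s : exists c : 'I_d -> E,
    (forall i, F (c i)) /\ w s = \sum_i c i *: v i.
  have /Sv/(kspan_rangeP v _ hF)[c Fc ->] : S s.+1 (w s) by case: (hw s).
  by exists c.
have [a ha] := choice coord.
have [c [Fc [s0 cs0] c0]] := subfield_kernel hF (fun s => (ha s).1).
have rel : \sum_s c s *: w s = 0.
  under eq_bigr => s _ do rewrite (ha s).2 scaler_sumr.
  rewrite exchange_big big1 // => i _.
  under eq_bigr => s _ do rewrite scalerA.
  by rewrite -scaler_suml c0 scale0r.
have Smon s t : (s <= t)%N -> S s `<=` S t.
  move=> /subnK <-; elim: (t - s)%N => // n IH z /IH; exact: incS.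
(* the last vector entering the relation *)
case: (@arg_maxnP _ s0 (fun s => c s != 0) (fun s => s : nat) cs0) => s cs smax.
apply: (hw s).2; rewrite -[w s]scale1r -(mulVf cs) -scalerA.
apply: (subspaceZ (hS s)); first exact: (subfieldV hF).
move/eqP: rel; rewrite (bigD1 s) //= addr_eq0 => /eqP ->.
apply: (subspaceN (hS s)); apply: (subspace_sum (hS s)) => t ts.
have [->|ct] := eqVneq (c t) 0; first by rewrite scale0r; apply: (subspace0 (hS s)).
apply: (subspaceZ (hS s)) => //; apply: (Smon t.+1); last by case: (hw t).
by rewrite ltn_neqAle ts; apply: smax.
Qed.

(** A spanning family of least length is a basis, since a member entering a
    linear relation could be dropped. *)
Lemma minimal_basis (E : fieldType) (K : set E) (V : lmodType E) (W : set V) n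
    (u : 'I_n -> V) : is_subfield K -> W = kspan K (range u) ->
  exists2 d, has_dim K W d
    & forall m (v : 'I_m -> V), W = kspan K (range v) -> (d <= m)%N.
Proof.
move=> hK Wu.
pose P m := `[< exists v : 'I_m -> V, W = kspan K (range v) >].
have exP : exists m, P m by exists n; apply/asboolP; exists u.
case: (ex_minnP exP) => d /asboolP[v Wv] dmin; exists d; last first.
  by move=> m w Ww; apply: dmin; apply/asboolP; exists w.
exists v => // c Kc rel i; apply/eqP; apply: contraT => ci.
case: d v Wv dmin c Kc rel i ci => [|d] v Wv dmin c Kc rel i ci; first by case: i ci.
suff : (d.+1 <= d)%N by rewrite ltnn.
apply/dmin/asboolP; exists (fun j => v (lift i j)).
rewrite Wv eqEsubset; split; last first.
  apply: (kspan_sub (kspan_subspace _ _)) => _ [j _ <-].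
  by apply: sub_kspan; exists (lift i j).
have hs := kspan_subspace K (range (fun j => v (lift i j))).
apply: (kspan_sub hs) => _ [j _ <-].
case: (unliftP i j) => [k ->|->]; first by apply: sub_kspan; exists k.
rewrite -[v i]scale1r -(mulVf ci) -scalerA.
apply: (subspaceZ hs); first exact: (subfieldV hK).
move/eqP: rel; rewrite (bigD1_ord i) //= addr_eq0 => /eqP ->.
apply: (subspaceN hs); apply: (subspace_sum hs) => k _.
by apply: (subspaceZ hs) => //; apply: sub_kspan; exists k.
Qed.

(** * Products of subspaces of a finite extension *)

Section Growth.
Variables (E : fieldType) (F K : set E) (V : nat -> set E).
Hypothesis hF : is_subfield F.
Hypothesis hFK : finite_extension F K.
Hypothesis V_subspace :
  forall i, (2 <= i)%N -> is_subspace F (V i : set E^o).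
Hypothesis V1 : forall i, (2 <= i)%N -> V i 1.
Hypothesis VK : K = subfield_gen (\bigcup_(i in [set i | (2 <= i)%N]) V i).
Hypothesis recur : forall j, (2 <= j)%N -> exists g, forall n, (2 <= n)%N ->
  exists2 m, (n <= m < n + g)%N & V m = V j.

(** The [F]-span of [V i * V i.+1 * ... * V (i + r).-1], which is [F] for the
    empty product. *)
Fixpoint window_prod i r : set E :=
  if r is s.+1 then
    kspan F ([set z | exists x y,
      [/\ window_prod i s x, V (i + s) y & z = x * y]] : set E^o)
  else F.

Let K_subfield : is_subfield K.
Proof. rewrite VK; exact: subfield_gen_subfield. Qed.

Lemma factor_sub_field i : (2 <= i)%N -> V i `<=` K.
Proof.
by move=> i2 x Vx; rewrite VK => A [_ sub]; apply: sub; exists i.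
Qed.

Lemma subfield_is_subspace (F' K' : set E) :
  is_subfield K' -> F' `<=` K' -> is_subspace F' (K' : set E^o).
Proof.
move=> hK' FK; apply/is_subspaceP; split; first exact: subfield0.
  exact: subfieldB.
by move=> a x /FK Fa Kx; apply: subfieldM.
Qed.

Lemma window_prod_subspace i r : is_subspace F (window_prod i r : set E^o).
Proof.
case: r => [|r]; last exact: kspan_subspace.
exact: subfield_is_subspace.
Qed.

Lemma window_prod_mul i r x y : window_prod i r x -> V (i + r) y ->
  window_prod i r.+1 (x * y).
Proof. by move=> Sx Vy; apply: sub_kspan; exists x, y. Qed.

Lemma window_prodS i r : (2 <= i)%N -> window_prod i r `<=` window_prod i r.+1.
Proof.
move=> i2 x Sx; rewrite -[x]mulr1; apply: window_prod_mul => //.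
by apply: V1; rewrite (leq_trans i2) ?leq_addr.
Qed.

Lemma window_prod_mono i r s : (2 <= i)%N -> (r <= s)%N ->
  window_prod i r `<=` window_prod i s.
Proof.
move=> i2 /subnK <-; elim: (s - r)%N => // n IH x /IH; exact: window_prodS.
Qed.

Lemma window_prod1 i r : (2 <= i)%N -> window_prod i r 1.
Proof.
by move=> i2; apply: (@window_prod_mono i 0) => //; apply: subfield1.
Qed.

Lemma window_prod_sub i r : (2 <= i)%N -> window_prod i r `<=` K.
Proof.
move=> i2; have hK := subfield_is_subspace K_subfield hFK.1.
elim: r => [|r IH]; first exact: hFK.1.
apply: (kspan_sub hK) => _ [x [y [Sx Vy ->]]].
apply: (subfieldM K_subfield); first exact: IH.
by apply: (@factor_sub_field (i + r)) => //; rewrite (leq_trans i2) ?leq_addr.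
Qed.

Lemma factor_scalars i : (2 <= i)%N -> F `<=` V i.
Proof.
move=> i2 a Fa; rewrite -[a]mulr1.
by apply: (subspaceZ (V_subspace i2)) => //; apply: V1.
Qed.

(** The fields generated by [V 2, ..., V n] exhaust [K], and a finite basis of
    [K] lies in one of them. *)
Lemma finitely_many_factors : exists2 n, (2 <= n)%N &
  K `<=` subfield_gen (\bigcup_(i in [set i | (2 <= i <= n)%N]) V i).
Proof.
pose G n := subfield_gen (\bigcup_(i in [set i | (2 <= i <= n)%N]) V i).
have hG n : is_subfield (G n) by apply: subfield_gen_subfield.
have Gmono m n : (m <= n)%N -> G m `<=` G n.
  move=> mn; apply: smallest_sub; first exact: hG.
  move=> x [i /= /andP[i2 im] Vx] A [_ sub]; apply: sub; exists i => //=.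
  by rewrite i2 (leq_trans im).
have hU : is_subfield (\bigcup_n G n).
  have common x y : (\bigcup_n G n) x -> (\bigcup_n G n) y ->
      exists2 n, G n x & G n y.
    move=> [m _ Gx] [n _ Gy]; exists (maxn m n).
      by apply: Gmono Gx; apply: leq_maxl.
    by apply: Gmono Gy; apply: leq_maxr.
  apply/is_subfieldP; split; first by exists 0%N => //; apply: (subfield1 (hG _)).
    by move=> x y Ux /(common _ _ Ux)[n Gx Gy]; exists n => //; apply: (subfieldB (hG n)).
  move=> x y Ux /(common _ _ Ux)[n Gx Gy]; exists n => //.
  exact: (subfield_div (hG n)).
have KU : K `<=` \bigcup_n G n.
  rewrite VK; apply: smallest_sub => // x [i i2 Vx]; exists i => //.
  by apply: sub_gen_smallest; exists i => //=; rewrite leqnn andbT.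
have [FK [d [v _ Kv]]] := hFK.
have vG i : exists n, G n (v i).
  have [] := KU (v i); last by move=> n _ Gv; exists n.
  by rewrite Kv; apply: sub_kspan; exists i.
have [n hn] := choice vG.
exists (maxn 2 (\max_i n i)); first exact: leq_maxl.
rewrite Kv; apply: (@kspan_sub _ F E^o).
  apply: subfield_is_subspace; first exact: hG.
  move=> a Fa; apply: sub_gen_smallest; exists 2%N => //=.
    by rewrite leq_maxl.
  exact: factor_scalars.
move=> _ [i _ <-]; apply: Gmono (hn i).
by rewrite (leq_trans _ (leq_maxr _ _)) // leq_bigmax.
Qed.

Lemma recur_uniform N : exists g, forall j, (2 <= j <= N)%N ->
  forall n, (2 <= n)%N -> exists2 m, (n <= m < n + g)%N & V m = V j.
Proof.
elim: N => [|N [g hg]]; first by exists 0%N => j; case/andP => /leq_trans h /h.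
have [N1|N1] := leqP N.+1 1.
  by exists 0%N => j /andP[/leq_trans h /h]; rewrite ltnNge N1.
have [g' hg'] := recur N1; exists (maxn g g') => j /andP[j2].
rewrite leq_eqVlt => /orP[/eqP ->|jN] n n2.
  have [m /andP[nm mg] Vm] := hg' n n2; exists m => //.
  by rewrite nm (leq_trans mg) // leq_add2l leq_maxr.
have [|m /andP[nm mg] Vm] := hg j _ n n2; first by rewrite j2.
exists m => //.
by rewrite nm (leq_trans mg) // leq_add2l leq_maxl.
Qed.

(** A scalar maps a finite-dimensional space [S] into itself only if its inverse
    does: the ascending chain [S, a^-1 S, a^-2 S, ...] pauses, and
    multiplication by a power of [a] turns any pause into [a^-1 S = S]. *)
Lemma stabiliser_subfield (S : set E) : is_subspace F (S : set E^o) -> S 1 ->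
  S `<=` K -> is_subfield [set a | forall x, S x -> S (a * x)].
Proof.
move=> hS S1 SK.
have stabK a : (forall x, S x -> S (a * x)) -> K a.
  by move=> /(_ 1 S1); rewrite mulr1 => /SK.
have inv a : (forall x, S x -> S (a * x)) -> forall x, S x -> S (a^-1 * x).
  move=> Sa; have [->|a0] := eqVneq a 0.
    by move=> x _; rewrite invr0 mul0r; apply: (subspace0 hS).
  have Ka := stabK a Sa.
  pose T s : set E^o := [set x | S (a ^+ s * x)].
  have [d [v _ Kv]] := hFK.2.
  have TK s x : T s x -> K x.
    move=> /SK Kx; rewrite -[x](mulKf (expf_neq0 s a0)).
    apply: (subfieldM K_subfield) => //; apply: (subfieldV K_subfield).
    elim: s {Kx} => [|s IH]; first exact: subfield1.
    by rewrite exprS; apply: (subfieldM K_subfield).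
  have [|||s _ Ts] := @subspace_chain_pause _ F E^o d v T hF.
  - move=> s; apply/is_subspaceP; split; first by rewrite /T /= mulr0; apply: (subspace0 hS).
      by move=> x y Tx Ty; rewrite /T /= mulrBr; apply: (subspaceB hS).
    move=> b x Fb Tx; rewrite /T /= mulrCA; exact: (subspaceZ hS).
  - by move=> s x; rewrite /T /= exprS -mulrA; apply: Sa.
  - by move=> s x /TK; rewrite Kv.
  (* a ^+ s.+1 sends this element to x, and a ^+ s sends it to a^-1 * x *)
  move=> x Sx; have := Ts (a ^- s * (a^-1 * x)).
  have as0 : a ^+ s != 0 by rewrite expf_neq0.
  rewrite /T /= exprS -mulrA mulVKf // mulVKf //; exact.
apply/is_subfieldP; split => /=.
- by move=> x Sx; rewrite mul1r.
- by move=> a b Sa Sb x Sx; rewrite mulrBl; apply: (subspaceB hS); auto.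
- by move=> a b Sa Sb x Sx; rewrite -mulrA; apply: Sa; apply: inv.
Qed.

(** Along a window that meets every [V j] of a finite generating set, the
    product either grows or is stable under a subfield containing them all,
    which is [K].  As the growth is bounded by the degree of [K], the length
    needed to reach [K] does not depend on the starting index. *)
Lemma window_prod_eventually_full :
  exists r, forall i, (2 <= i)%N -> K `<=` window_prod i r.
Proof.
have [N N2 KN] := finitely_many_factors.
have [g hg] := recur_uniform N.
have [d [v _ Kv]] := hFK.2.
exists (d * g)%N => i i2.
have [|||s sd Ss] := @subspace_chain_pause _ F E^o d v
    (fun s => window_prod i (s * g)) hF.
- by move=> s; apply: window_prod_subspace.
- by move=> s; apply: window_prod_mono => //; rewrite leq_mul2r leqnSn orbT.
- by move=> s; rewrite -Kv; apply: window_prod_sub.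
set S := window_prod i (s * g) in Ss.
have S1 : S 1 by apply: window_prod1.
have hS : is_subspace F (S : set E^o) by apply: window_prod_subspace.
have SV j x y : (2 <= j <= N)%N -> V j y -> S x -> S (y * x).
  move=> jN Vy Sx.
  have [|m /andP[im mg] Vm] := hg j jN (i + s * g)%N.
    by rewrite (leq_trans i2) ?leq_addr.
  apply: Ss; apply: (@window_prod_mono i (m - i).+1) => //.
    by rewrite mulSn; lia.
  rewrite mulrC; apply: window_prod_mul.
    apply: window_prod_mono Sx => //; lia.
  by rewrite subnKC ?Vm //; lia.
have SK : S `<=` K by apply: window_prod_sub.
have stab := stabiliser_subfield hS S1 SK.
move=> a Ka; apply: (@window_prod_mono i (s * g)) => //.
  by rewrite leq_mul2r sd orbT.
rewrite -[a]mulr1.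
suff sub : K `<=` [set a | forall x, S x -> S (a * x)] by apply: sub.
apply: subset_trans KN _; apply: smallest_sub => // y [j jN Vy] x.
exact: SV Vy.
Qed.

End Growth.

(** * Brackets *)

Section Lie.
Variables (E : fieldType) (M : lieAlgType E).
Implicit Types (x y z u v w : M) (a b : E).

Lemma lieDl x y z : lie (x + y) z = lie x z + lie y z.
Proof. by have := lie_linearl z 1 x y; rewrite !scale1r. Qed.

Lemma lieDr x y z : lie z (x + y) = lie z x + lie z y.
Proof. by have := lie_linearr z 1 x y; rewrite !scale1r. Qed.

Lemma lie0l x : lie 0 x = 0 :> M.
Proof. by apply: (addrI (lie 0 x)); rewrite -lieDl !addr0. Qed.

Lemma lie0r x : lie x 0 = 0 :> M.
Proof. by apply: (addrI (lie x 0)); rewrite -lieDr !addr0. Qed.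

Lemma lieZl a x y : lie (a *: x) y = a *: lie x y.
Proof. by have := lie_linearl y a x 0; rewrite !addr0 lie0l addr0. Qed.

Lemma lieZr a x y : lie x (a *: y) = a *: lie x y.
Proof. by have := lie_linearr x a y 0; rewrite !addr0 lie0r addr0. Qed.

Lemma lieNl x y : lie (- x) y = - lie x y.
Proof. by rewrite -scaleN1r lieZl scaleN1r. Qed.

Lemma lieNr x y : lie x (- y) = - lie x y.
Proof. by rewrite -scaleN1r lieZr scaleN1r. Qed.

Lemma lieBl x y z : lie (x - y) z = lie x z - lie y z.
Proof. by rewrite lieDl lieNl. Qed.

Lemma lieBr x y z : lie z (x - y) = lie z x - lie z y.
Proof. by rewrite lieDr lieNr. Qed.

Lemma lieC x y : lie x y = - lie y x.
Proof.
have := liexx (x + y); rewrite lieDl !lieDr !liexx add0r addr0.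
by move/eqP; rewrite addr_eq0 => /eqP.
Qed.

Lemma lie_leibniz u v w : lie (lie u v) w = lie (lie u w) v + lie u (lie v w).
Proof.
have := lie_jacobi u v w.
rewrite (lieC v (lie w u)) (lieC w u) lieNl opprK (lieC w (lie u v)).
by move/eqP; rewrite subr_eq0 addrC => /eqP.
Qed.

Lemma lie_det u v a b c d :
  lie (a *: u + b *: v) (c *: u + d *: v) = (a * d - b * c) *: lie u v.
Proof.
rewrite lieDl !lieDr !lieZl !lieZr !liexx !scaler0 add0r addr0 (lieC v u).
by rewrite !scalerN !scalerA -scalerBl.
Qed.

Lemma lie_set_min (X Y W : set M) : zmod_closed [in W] ->
  (forall x y, X x -> Y y -> W (lie x y)) -> lie_set X Y `<=` W.
Proof.
by move=> hW XYW; apply: smallest_sub => // _ [x [y [Xx Yy ->]]]; apply: XYW.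
Qed.

Lemma mem_lie_set (X Y : set M) x y : X x -> Y y -> lie_set X Y (lie x y).
Proof. by move=> Xx Yy; apply: sub_gen_smallest; exists x, y. Qed.

Lemma zmod_closedP (W : set M) :
  zmod_closed [in W] <-> W 0 /\ forall x y, W x -> W y -> W (x - y).
Proof.
split=> [[h0 hB]|[h0 hB]]; split; do ?by move: h0; rewrite !inE.
  by move=> x y Wx Wy; have := hB x y; rewrite !inE; apply.
by move=> x y; rewrite !inE; apply: hB.
Qed.

Lemma lie_set_closed (X Y : set M) : zmod_closed [in lie_set X Y].
Proof.
apply/zmod_closedP; split; first by move=> A [/zmod_closedP[]].
move=> x y Xx Xy A hA; have [/zmod_closedP[_ hB] _] := hA.
by apply: hB; [apply: Xx | apply: Xy].
Qed.

End Lie.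

(** * Lie algebras of maximal class *)

Section MaximalClass.
Variables (E : fieldType) (M : lieAlgType E) (Mg : nat -> set M).
Hypothesis hM : maximal_class Mg.
Implicit Types (x y z u v w : M) (a b : E).

Lemma setT_subfield : is_subfield (setT : set E).
Proof. by apply/is_subfieldP. Qed.

Lemma homog_subspace i : (1 <= i)%N -> is_subspace setT (Mg i).
Proof. by case: hM => _ h _ _ _; apply: h. Qed.

Lemma homogZ i a u : (1 <= i)%N -> Mg i u -> Mg i (a *: u).
Proof. by move=> i1 Mu; apply: (subspaceZ (homog_subspace i1)). Qed.

Lemma homog_lie i j u v : (1 <= i)%N -> (1 <= j)%N -> Mg i u -> Mg j v ->
  Mg (i + j)%N (lie u v).
Proof.
by move=> i1 j1 Mu Mv; case: hM => _ _ h _ _; apply: h => //; apply: mem_lie_set.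
Qed.

Lemma homog_lie1 i u x : (1 <= i)%N -> Mg i u -> Mg 1%N x -> Mg i.+1 (lie u x).
Proof. by move=> i1 Mu Mx; rewrite -addn1; apply: homog_lie. Qed.

Lemma homog_gen i : (1 <= i)%N -> Mg i.+1 = lie_set (Mg i) (Mg 1%N).
Proof. by move=> i1; case: hM => _ _ _ h _; rewrite h. Qed.

Lemma homog_line i : (2 <= i)%N ->
  exists e, [/\ Mg i e, e != 0 & forall u, Mg i u -> exists a, u = a *: e].
Proof.
case: hM => _ _ _ _ [_ h] /h[v vfree Mv]; exists (v ord0); split.
- by rewrite Mv; apply: sub_kspan; exists ord0.
- apply/negP => /eqP v0; have /eqP := oner_neq0 E; apply.
  by apply: (vfree (fun=> 1)) ord0 => //; rewrite big_ord1 v0 scaler0.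
- move=> u; rewrite Mv => /(kspan_rangeP _ _ setT_subfield)[c _ ->].
  by exists (c ord0); rewrite big_ord1.
Qed.

Lemma homog_spanned i e : (2 <= i)%N -> Mg i e -> e != 0 ->
  forall u, Mg i u -> exists a, u = a *: e.
Proof.
move=> i2 Me e0 u Mu; have [f [_ _ fP]] := homog_line i2.
have [a ea] := fP e Me; have [b ->] := fP u Mu.
exists (b / a); rewrite ea scalerA divfK //.
by apply: contraNneq e0 => a0; rewrite ea a0 scale0r.
Qed.

Lemma homog_lie_neq0 i : (1 <= i)%N ->
  ~ (forall u x, Mg i u -> Mg 1%N x -> lie u x = 0).
Proof.
move=> i1 h0; have [e [Me e0 _]] := @homog_line i.+1 i1.
have sub : lie_set (Mg i) (Mg 1%N) `<=` [set 0].
  apply: lie_set_min => [|u x Mu Mx]; last exact: h0.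
  by apply/zmod_closedP; split=> // x y -> ->; rewrite /= subr0.
by move: Me; rewrite homog_gen // => /sub /eqP; rewrite (negPf e0).
Qed.

Lemma degree1_basis : exists v w, [/\ Mg 1%N v, Mg 1%N w
  & forall x, Mg 1%N x -> exists a b, x = a *: v + b *: w].
Proof.
case: hM => _ _ _ _ [[v _ Mv] _].
exists (v ord0), (v ord_max); split.
- by rewrite Mv; apply: sub_kspan; exists ord0.
- by rewrite Mv; apply: sub_kspan; exists ord_max.
move=> x; rewrite Mv => /(kspan_rangeP _ _ setT_subfield)[c _ ->].
exists (c ord0), (c ord_max); rewrite big_ord_recl big_ord1.
by congr (_ + c _ *: v _); apply/val_inj.
Qed.

Lemma spanning_lie_neq0 v w :
  (forall x, Mg 1%N x -> exists a b, x = a *: v + b *: w) -> lie v w != 0.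
Proof.
move=> vw; apply/negP => /eqP vw0; apply: (@homog_lie_neq0 1) => // u x.
move=> /vw[a [b ->]] /vw[c [d ->]].
by rewrite lie_det vw0 scaler0.
Qed.

(** Cramer's rule: the bracket of two vectors of degree 1 is their determinant
    times a fixed vector. *)
Lemma lie_neq0_spanning u v : Mg 1%N u -> Mg 1%N v -> lie u v != 0 ->
  forall x, Mg 1%N x -> exists a b, x = a *: u + b *: v.
Proof.
have [p [q [_ _ pq]]] := degree1_basis.
move=> /pq[a [b ->]] /pq[c [d ->]]; rewrite lie_det scaler_eq0 negb_or.
move=> /andP[D0 _] _ /pq[s [t ->]].
set D := a * d - b * c in D0.
exists ((s * d - t * c) / D), ((a * t - b * s) / D).
rewrite !scalerDr !scalerA addrACA -!scalerDl.
by congr (_ *: _ + _ *: _); rewrite /D; field.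
Qed.

Lemma degree1_noncentral y : Mg 1%N y -> y != 0 ->
  exists2 x, Mg 1%N x & lie y x != 0.
Proof.
have [p [q [Mp Mq pq]]] := degree1_basis => /pq[a [b ->]] y0.
have pq0 := spanning_lie_neq0 pq.
have [b0|b0] := eqVneq b 0; [exists q | exists p] => //.
  have a0 : a != 0 by apply: contraNneq y0 => ->; rewrite b0 !scale0r addr0.
  by rewrite b0 scale0r addr0 lieZl scaler_eq0 (negPf a0).
rewrite lieDl !lieZl liexx scaler0 add0r scaler_eq0 (negPf b0) lieC oppr_eq0.
exact: pq0.
Qed.

Lemma centraliser_line i : (2 <= i)%N -> exists2 y, y != 0 &
  centraliser Mg i = [set x | exists a, x = a *: y].
Proof.
move=> i2; have i1 : (1 <= i)%N by apply: leq_trans i2.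
have [p [q [Mp Mq pq]]] := degree1_basis.
have pq0 := spanning_lie_neq0 pq.
have [e [Me e0 eP]] := homog_line i2.
have [f [_ f0 fP]] := homog_line (leqW i2).
have [s hs] := fP _ (homog_lie1 i1 Me Mp).
have [t ht] := fP _ (homog_lie1 i1 Me Mq).
have lie_pq a b : lie e (a *: p + b *: q) = (a * s + b * t) *: f.
  by rewrite lieDr !lieZr hs ht !scalerA scalerDl.
have st0 : (s != 0) || (t != 0).
  apply: contraT; rewrite negb_or !negbK => /andP[/eqP s0 /eqP t0].
  case: (@homog_lie_neq0 i i1) => u x /eP[a ->] /pq[b [c ->]].
  by rewrite lieZl lie_pq s0 t0 !mulr0 addr0 scale0r scaler0.
have My : Mg 1%N (t *: p - s *: q).
  by apply: (subspaceB (homog_subspace _)) => //; apply: homogZ.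
exists (t *: p - s *: q).
  apply: contraTneq st0 => y0.
  have /eqP : lie (t *: p - s *: q) q = 0 by rewrite y0 lie0l.
  rewrite lieBl !lieZl liexx scaler0 subr0 scaler_eq0 (negPf pq0) orbF => /eqP->.
  have /eqP : lie p (t *: p - s *: q) = 0 by rewrite y0 lie0r.
  rewrite lieBr !lieZr liexx scaler0 sub0r oppr_eq0 scaler_eq0 (negPf pq0) orbF.
  by move=> /eqP->; rewrite eqxx.
apply/seteqP; split=> [x [Mx cx]|_ [a ->]]; last first.
  split=> [|u /eP[b ->]]; first exact: homogZ.
  rewrite lieZl lieZr -scaleNr lie_pq.
  by rewrite (_ : t * s + - s * t = 0) ?scale0r ?scaler0 //; ring.
have [a [b xab]] := pq x Mx.
have /eqP := cx e Me; rewrite xab lie_pq scaler_eq0 (negPf f0) orbF => /eqP ab0.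
have [t0|t0] := eqVneq t 0.
  move: st0; rewrite t0 eqxx orbF => s0; exists (- b / s).
  move: ab0; rewrite t0 mulr0 addr0 => /eqP; rewrite mulf_eq0 (negPf s0) orbF.
  move=> /eqP->; rewrite !scale0r !add0r scalerN scalerA -scaleNr.
  by congr (_ *: _); field.
exists (a / t); rewrite /= scalerBr !scalerA -scaleNr.
congr (_ *: _ + _ *: _); first by field.
apply: (mulIf t0); rewrite mulNr [a / t * s]mulrAC divfK //.
by apply/eqP; rewrite -addr_eq0 addrC ab0.
Qed.

Lemma centraliser_eq i j y : (2 <= i)%N -> (2 <= j)%N -> y != 0 ->
  centraliser Mg i y -> centraliser Mg j y -> centraliser Mg i = centraliser Mg j.
Proof.
move=> i2 j2 y0.
have line k : (2 <= k)%N -> centraliser Mg k y ->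
    centraliser Mg k = [set x | exists a, x = a *: y].
  move=> k2; have [z z0 ->] := centraliser_line k2 => -[a yaz].
  have a0 : a != 0 by apply: contraNneq y0 => a0; rewrite yaz a0 scale0r.
  apply/seteqP; split=> _ [b ->].
    by exists (b / a); rewrite yaz scalerA divfK.
  by exists (b * a); rewrite yaz scalerA.
by move=> /(line _ i2)-> /(line _ j2)->.
Qed.

End MaximalClass.

(** * Recurrence of the two-step centralisers *)

Section Derivations.
Variables (E : fieldType) (M : lieAlgType E).
Implicit Types (u v : M) (d : M -> M).

Definition derivation d :=
  {morph d : u v / u + v} /\
  forall u v, d (lie u v) = lie (d u) v + lie u (d v).

Lemma derivation0 d : derivation d -> d 0 = 0.
Proof. by case=> dD _; apply: (addrI (d 0)); rewrite -dD !addr0. Qed.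

Lemma derivationN d u : derivation d -> d (- u) = - d u.
Proof.
move=> hd; apply/eqP; rewrite -addr_eq0; have [dD _] := hd.
by rewrite -dD addNr derivation0.
Qed.

Lemma derivationMn d u n : derivation d -> d (u *+ n) = d u *+ n.
Proof.
move=> hd; have [dD _] := hd; elim: n => [|n IH]; first exact: derivation0.
by rewrite !mulrS dD IH.
Qed.

Lemma leibniz_iter d n u v : derivation d -> iter n d (lie u v) =
  \sum_(i < n.+1) lie (iter (n - i) d u) (iter i d v) *+ 'C(n, i).
Proof.
move=> hd; have [dD dL] := hd; elim: n => [|n IH]; first by rewrite big_ord1.
rewrite iterS IH (big_morph d dD (derivation0 hd)).
pose G i := lie (iter (n.+1 - i) d u) (iter i d v).
have stepE (i : 'I_n.+1) :
    d (lie (iter (n - i) d u) (iter i d v) *+ 'C(n, i))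
    = G i *+ 'C(n, i) + G i.+1 *+ 'C(n, i).
  rewrite derivationMn // dL mulrnDl /G subSS subSn; last by rewrite -ltnS.
  by rewrite !iterS.
rewrite (eq_bigr _ (fun i _ => stepE i)) big_split /=.
rewrite [RHS]big_ord_recl /= bin0.
under [in RHS]eq_bigr => i _ do rewrite /bump add1n binS mulrnDr -/(G i.+1).
rewrite big_split /= addrA; congr (_ + _).
rewrite big_ord_recl bin0 big_ord_recr /= bin_small // mulr0n addr0.
by congr (_ + _); apply: eq_bigr => i _; rewrite /bump add1n.
Qed.

(** In characteristic [p] the inner binomial coefficients of Leibniz's rule
    for the [p]-th power vanish. *)
Lemma derivation_iter_pchar p d : p \in [pchar E] -> derivation d ->
  derivation (iter p d).
Proof.
move=> pE hd; have [dD _] := hd.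
have p_pr := pcharf_prime pE; have p_gt0 := prime_gt0 p_pr.
have pM (w : M) : w *+ p = 0.
  by rewrite -scaler_nat (pcharf0 pE) scale0r.
split=> [u v|u v].
  by elim: p {pE p_pr p_gt0 pM} => //= p ->.
rewrite leibniz_iter // -(prednK p_gt0) in pM *.
rewrite big_ord_recl big_ord_recr /= big1 ?add0r.
  by rewrite bin0 /bump add1n binn subnn !mulr1n.
move=> i _; have /dvdnP[c ->] : (p.-1.+1 %| 'C(p.-1.+1, bump 0 i))%N.
  by rewrite prednK // prime_dvd_bin // /bump add1n /=; have := ltn_ord i; lia.
by rewrite mulnC mulrnA pM mul0rn.
Qed.

Lemma derivation_iter_pchar_exp p k d : p \in [pchar E] -> derivation d ->
  derivation (iter (p ^ k) d).
Proof.
move=> pE hd; elim: k => [|k IH] //.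
have [dD dL] := derivation_iter_pchar pE IH.
have E1 u : iter (p ^ k.+1) d u = iter p (iter (p ^ k) d) u.
  have iterM m : iter (m * p ^ k) d u = iter m (iter (p ^ k) d) u.
    by elim: m => // m IHm; rewrite mulSn iterD IHm.
  by rewrite expnS iterM.
by split=> [u v|u v]; rewrite !E1.
Qed.

Lemma derivation_lie_right (y : M) : derivation (lie ^~ y).
Proof. by split=> [u v|u v]; [apply: lieDl | apply: lie_leibniz]. Qed.

End Derivations.

Section Recurrence.
Variables (E : fieldType) (M : lieAlgType E) (Mg : nat -> set M).
Hypothesis hM : maximal_class Mg.
Implicit Types (x y z u v w : M) (a b : E).

(** If [y] centralises [Mg j], then [(ad y) ^ j] kills [Mg 1].  Hence so does
    [(ad y) ^ q] for a power [q >= j] of the characteristic, but this is a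
    derivation and [Mg 1] generates the algebra. *)
Lemma adjoint_nilpotent p j y : p \in [pchar E] -> (2 <= j)%N ->
  centraliser Mg j y ->
  forall i u, (1 <= i)%N -> Mg i u -> iter (p ^ j) (lie ^~ y) u = 0.
Proof.
move=> pE j2 [My yj].
have hd := derivation_iter_pchar_exp j pE (derivation_lie_right y).
have hy := derivation_lie_right y.
have [dD dL] := hd.
have kill1 x : Mg 1%N x -> iter (p ^ j) (lie ^~ y) x = 0.
  move=> Mx.
  have deg i : Mg i.+1 (iter i (lie ^~ y) x).
    by elim: i => [|i IH] //=; apply: (homog_lie1 hM).
  have p1 : (1 < p)%N := prime_gt1 (pcharf_prime pE).
  rewrite -(subnK (ltnW (ltn_expl j p1))) iterD.
  have -> : iter j (lie ^~ y) x = 0.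
    by rewrite -(prednK (ltnW j2)) iterS yj // -{1}(prednK (ltnW j2)).
  by elim: (_ - _)%N => // n IH; rewrite iterS IH lie0l.
case=> // i u _; elim: i u => [|i IH] u; first exact: kill1.
rewrite (homog_gen hM) // => Mu.
have : lie_set (Mg i.+1) (Mg 1%N) `<=`
    [set u | iter (p ^ j) (lie ^~ y) u = 0].
  apply: lie_set_min => [|v x Mv Mx] /=.
    apply/zmod_closedP; split; first exact: (derivation0 hd).
    by move=> v w /= v0 w0; rewrite dD (derivationN _ hd) v0 w0 subr0.
  by rewrite dL IH // kill1 // lie0l lie0r addr0.
exact.
Qed.

(** In characteristic 0 all the two-step centralisers coincide.  Let [y] span
    the first one, [e 2 = [y, x]], [e i.+1 = [e i, x]], and let [f = [e n, y]]
    be the first non-zero bracket of this kind.  Jacobi's identity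
    [[e i, e j.+1] = [[e i, e j], x] - [e i.+1, e j]] gives
    [[e i, e j] = (-1) ^ j.+1 f] for [i + j = n.+1].  If [n] is odd, taking
    [i = j] gives [f = 0].  If [n = 2 k], then [f] is a bracket of two elements
    killed by [ad y], so [[f, y] = 0]; the next weight gives
    [[e i, e j] = (-1) ^ j (j - 1) [f, x]] for [i + j = n.+2], so that
    [k [f, x] = 0] with [i = j = k.+1].  Then [f] would be central. *)
Lemma centraliser_pchar0 y : (forall k, (0 < k)%N -> k%:R != 0 :> E) ->
  y != 0 -> centraliser Mg 2 y -> forall n, (2 <= n)%N -> centraliser Mg n y.
Proof.
move=> char0 y0 [My y2] n n2; split=> //.
elim/ltn_ind: n n2 => n IH n2.
have [->//|n3] := eqVneq n 2%N.
have {n2 n3} n3 : (3 <= n)%N by rewrite ltn_neqAle eq_sym n3.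
have [x Mx yx0] := degree1_noncentral hM My y0.
have yx := lie_neq0_spanning hM My Mx yx0.
pose e i := iter (i - 2) (lie ^~ x) (lie y x).
have eS i : (2 <= i)%N -> e i.+1 = lie (e i) x.
  by move=> i2; rewrite /e subSn.
have Me i : (2 <= i)%N -> Mg i (e i).
  elim: i => // i IHi; rewrite leq_eqVlt => /orP[/eqP <-|i2].
    exact: (homog_lie1 hM).
  by rewrite eS //; apply: (homog_lie1 hM) (ltnW i2) _ Mx; apply: IHi.
have ey i : (2 <= i)%N -> (i < n)%N -> lie (e i) y = 0.
  by move=> i2 iltn; apply: (IH i) => //; apply: Me.
have e0 i : (2 <= i)%N -> (i <= n)%N -> e i != 0.
  elim: i => // i IHi; rewrite leq_eqVlt => /orP[/eqP <- //|i2] iltn.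
  have ei0 := IHi i2 (ltnW iltn).
  rewrite eS //; apply/eqP => ex0.
  apply: (@homog_lie_neq0 _ _ _ hM i (ltnW i2)) => u z.
  move=> /(homog_spanned hM i2 (Me _ i2) ei0)[a ->] /yx[b [c ->]].
  by rewrite lieZl lieDr !lieZr ex0 ey // !scaler0 addr0 scaler0.
pose f := lie (e n) y.
suff f0 : f = 0.
  move=> u Mu; have n2 := ltnW n3.
  have [a ->] := homog_spanned hM n2 (Me _ n2) (e0 _ n2 (leqnn n)) Mu.
  by rewrite lieZl -/f f0 scaler0.
apply/eqP; apply: contraT => f0.
have lie_e2 i : (2 <= i)%N ->
    lie (e i) (e 2%N) = lie (lie (e i) y) x - lie (e i.+1) y.
  by move=> i2; rewrite (lie_leibniz (e i) y x) (eS i) // addrAC subrr add0r.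
have lie_eS i j : (2 <= i)%N -> (2 <= j)%N ->
    lie (e i) (e j.+1) = lie (lie (e i) (e j)) x - lie (e i.+1) (e j).
  by move=> i2 j2; rewrite (lie_leibniz (e i) (e j) x) !eS // addrAC subrr add0r.
have low i j : (2 <= i)%N -> (2 <= j)%N -> (i + j <= n)%N ->
    lie (e i) (e j) = 0.
  elim: j i => // j IHj i i2; rewrite leq_eqVlt => /orP[/eqP <-|j2] ijn.
    by rewrite lie_e2 // !ey ?lie0l ?subr0 //; lia.
  by rewrite lie_eS // !IHj ?lie0l ?subr0 //; lia.
have weight1 i j : (2 <= i)%N -> (2 <= j)%N -> (i + j = n.+1)%N ->
    lie (e i) (e j) = (-1) ^+ j.+1 *: f.
  elim: j i => // j IHj i i2; rewrite leq_eqVlt => /orP[/eqP <-|j2] ijn.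
    rewrite lie_e2 // ey; [|lia..]; rewrite lie0l sub0r.
    have -> : i.+1 = n by lia.
    by rewrite -/f exprS sqrrN expr1n mulr1 scaleN1r.
  rewrite lie_eS // low ?lie0l ?sub0r; [|lia..].
  by rewrite IHj; [rewrite [in RHS]exprS mulN1r scaleNr|lia..].
have sign0 m (w : M) : (-1) ^+ m *: w = 0 -> w = 0.
  by move/eqP; rewrite scaler_eq0 signr_eq0 => /eqP.
have [nodd|neven] := boolP (odd n).
  have [k nk] : exists k, n.+1 = (k + k)%N.
    by exists n.+1./2; rewrite addnn -[LHS]odd_double_half /= nodd.
  have k2 : (2 <= k)%N by lia.
  have := weight1 k k k2 k2 (esym nk); rewrite liexx => /esym/sign0 f00.
  by rewrite f00 eqxx in f0.
have [k nk] : exists k, n = (k + k)%N.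
  by exists n./2; rewrite addnn -[LHS]odd_double_half (negPf neven).
have fy : lie f y = 0.
  apply: (sign0 k.+2); rewrite -lieZl -(weight1 k k.+1); [|lia..].
  by rewrite lie_leibniz !ey ?lie0l ?lie0r ?addr0 //; lia.
have Mf : Mg n.+1 f by apply: (homog_lie1 hM) => //; [lia | apply: Me; lia].
have fspan := homog_spanned hM (leqW (ltnW n3)) Mf f0.
have eSy : lie (e n.+1) y = 0.
  have [|a ->] := fspan (e n.+1); first by apply: Me; lia.
  by rewrite lieZl fy scaler0.
have weight2 i j : (2 <= i)%N -> (2 <= j)%N -> (i + j = n.+2)%N ->
    lie (e i) (e j) = ((-1) ^+ j * (j.-1)%:R) *: lie f x.
  elim: j i => // j IHj i i2; rewrite leq_eqVlt => /orP[/eqP <-|j2] ijn.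
    have -> : i = n by lia.
    by rewrite lie_e2 ?(ltnW n3) // eSy subr0 -/f sqrrN expr1n mul1r scale1r.
  rewrite lie_eS // weight1 ?IHj; [|lia..].
  rewrite lieZl -scalerBl; congr (_ *: _).
  have -> : (j.+1.-1)%:R = 1 + (j.-1)%:R :> E.
    by rewrite /= -{1}(prednK (ltnW j2)) -natr1 addrC.
  by rewrite exprS; ring.
have fx : lie f x = 0.
  have k0 : (0 < k)%N by lia.
  have := weight2 k.+1 k.+1 ltac:(lia) ltac:(lia) ltac:(lia).
  move=> /esym/eqP; rewrite liexx scaler_eq0 mulf_eq0 signr_eq0 /=.
  by rewrite (negPf (char0 k k0)) => /eqP.
exfalso; apply: (@homog_lie_neq0 _ _ _ hM n.+1) => // u z /fspan[a ->].
by move=> /yx[b [c ->]]; rewrite lieZl lieDr !lieZr fx fy !scaler0 addr0 scaler0.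
Qed.

(** In characteristic [p], if [p ^ j] consecutive components were not
    centralised by [y], then [(ad y) ^ (p ^ j)] would not vanish. *)
Theorem centraliser_recurs j : (2 <= j)%N -> exists g, forall n, (2 <= n)%N ->
  exists2 m, (n <= m < n + g)%N & centraliser Mg m = centraliser Mg j.
Proof.
move=> j2.
have [[p pE]|nochar] := pselect (exists p, p \in [pchar E]).
  have [y y0 cy] := centraliser_line hM j2.
  have yj : centraliser Mg j y by rewrite cy; exists 1; rewrite scale1r.
  exists (p ^ j)%N => n n2; apply: contrapT => noc.
  have My : Mg 1%N y by case: yj.
  have [u [Mu u0 _]] := homog_line hM n2.
  have step i : (i <= p ^ j)%N ->
      Mg (n + i)%N (iter i (lie ^~ y) u) /\ iter i (lie ^~ y) u != 0.
    elim: i => [|i IHi] ip; first by rewrite addn0.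
    have [Mi i0] := IHi (ltnW ip); rewrite addnS iterS.
    have ni2 : (2 <= n + i)%N by lia.
    split; first by apply: (homog_lie1 hM) => //; lia.
    apply/negP => /eqP iy; apply: noc; exists (n + i)%N; first by lia.
    apply: (centraliser_eq hM ni2 j2 y0 _ yj); split=> // v.
    by move=> /(homog_spanned hM ni2 Mi i0)[a ->]; rewrite lieZl iy scaler0.
  have [_ /eqP] := step _ (leqnn _); apply.
  by apply: (adjoint_nilpotent pE j2 yj _ Mu); lia.
have char0 k : (0 < k)%N -> k%:R != 0 :> E.
  have /pcharf0P -> : [pchar E] =i pred0.
    by move=> p; apply/negP => pE; apply: nochar; exists p.
  by rewrite lt0n.
have [y y0 cy] := centraliser_line hM (leqnn 2).
have y2 : centraliser Mg 2 y by rewrite cy; exists 1; rewrite scale1r.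
have yn := centraliser_pchar0 char0 y0 y2.
exists 1%N => n n2; exists n; first by rewrite leqnn addn1 ltnSn.
by apply: (centraliser_eq hM n2 j2 y0); apply: yn.
Qed.

End Recurrence.

(** * Sums of homogeneous components *)

Section Tail.
Variables (E : fieldType) (F : set E) (M : lieAlgType E).
Implicit Types (A : nat -> set M) (W : set M) (x : M).

Lemma tail_extend A k x n (f : nat -> M) m : (forall i, (k <= i)%N -> A i 0) ->
  (forall i, (k <= i)%N -> A i (f i)) -> x = \sum_(k <= i < n) f i -> (n <= m)%N ->
  exists2 g : nat -> M, forall i, (k <= i)%N -> A i (g i)
                      & x = \sum_(k <= i < m) g i.
Proof.
move=> A0 Af -> nm; exists (fun i => if (i < n)%N then f i else 0).
  by move=> i ki; case: ifP => _; auto.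
by rewrite (big_nat_widen _ _ _ _ _ nm) big_mkcond.
Qed.

Lemma tail_min A k W : is_subspace F W -> (forall i, (k <= i)%N -> A i `<=` W) ->
  tail A k `<=` W.
Proof.
move=> hW AW _ [n [f [Af ->]]]; rewrite big_nat_cond.
apply: (subspace_sum hW) => i /andP[/andP[ki _] _].
exact: (AW i) (Af i ki).
Qed.

Section Subspaces.
Variables (A : nat -> set M) (k : nat).
Hypothesis hA : forall i, (k <= i)%N -> is_subspace F (A i).

Let A0 i : (k <= i)%N -> A i 0.
Proof. by move=> ki; apply: (subspace0 (hA ki)). Qed.

Lemma mem_tail i x : (k <= i)%N -> A i x -> tail A k x.
Proof.
move=> ki Ax; exists i.+1, (fun j => if j == i then x else 0); split.
  by move=> j kj; case: eqP => [->|_] //; apply: A0.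
rewrite big_nat_recr //= eqxx big_nat_cond big1 ?add0r // => j.
by case: eqP => // ->; rewrite ltnn andbF.
Qed.

Lemma tail_subspace : is_subspace F (tail A k).
Proof.
apply/is_subspaceP; split.
- by apply: (@mem_tail k) => //; apply: A0.
- move=> x y [n [f [Af xf]]] [m [g [Ag yg]]].
  have [f' Af' ->] := tail_extend A0 Af xf (leq_maxl n m).
  have [g' Ag' ->] := tail_extend A0 Ag yg (leq_maxr n m).
  exists (maxn n m), (fun i => f' i - g' i).
  by rewrite sumrB; split=> // i ki; apply: (subspaceB (hA ki)); auto.
- move=> a _ Fa [n [f [Af ->]]]; exists n, (fun i => a *: f i).
  by rewrite scaler_sumr; split=> // i ki; apply: (subspaceZ (hA ki)); auto.
Qed.

End Subspaces.
End Tail.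

(** * The Lie algebra generated by a subspace of degree 1 *)

Section Generated.
Variables (E : fieldType) (F : set E) (M : lieAlgType E) (Mg : nat -> set M)
  (L1 : set M).
Hypothesis hF : is_subfield F.
Hypothesis hM : maximal_class Mg.
Hypothesis hL1 : is_subspace F L1.
Hypothesis hL1M : L1 `<=` Mg 1%N.
Hypothesis hEL1 : kspan setT L1 = Mg 1%N.
Implicit Types (x y z u v w : M) (a b : E).

Local Notation K := (two_step_field Mg L1).
Local Notation L := (lie_comp L1).

Lemma lie_compS i u x : (1 <= i)%N -> L i u -> L1 x -> L i.+1 (lie u x).
Proof. by case: i => // i _ Lu Lx; apply: mem_lie_set. Qed.

Lemma lie_comp_subspace i : (1 <= i)%N -> is_subspace F (L i).
Proof.
elim: i => // -[|i] IH _; first exact: hL1.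
have hS : zmod_closed [in L i.+2] by apply: lie_set_closed.
split=> // a x Fa; have [h0 hB] := (zmod_closedP _).1 hS.
apply: (@lie_set_min _ _ _ _ [set x | L i.+2 (a *: x)]) => [|u v Lu Lv] /=.
  apply/zmod_closedP; split; first by rewrite /= scaler0.
  by move=> u v Lu Lv; rewrite /= scalerBr; apply: hB.
by rewrite -lieZr; apply: mem_lie_set => //; apply: (subspaceZ hL1).
Qed.

Lemma lie_comp_sub i : (1 <= i)%N -> L i `<=` Mg i.
Proof.
elim: i => // -[|i] IH _ //; apply: lie_set_min => [|u x Lu Lx].
  by have [] := homog_subspace hM (ltn0Sn i.+1).
by apply: (homog_lie1 hM) => //; [apply: IH | apply: hL1M].
Qed.

Lemma degree1_ind (W : set M) : is_subspace setT W -> L1 `<=` W -> Mg 1%N `<=` W.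
Proof. by move=> hW LW; rewrite -hEL1; apply: kspan_sub. Qed.

Lemma annihilates_degree1 u : (forall x, L1 x -> lie u x = 0) ->
  forall x, Mg 1%N x -> lie u x = 0.
Proof.
move=> ux; apply: (degree1_ind (W := [set x | lie u x = 0])) => //.
apply/is_subspaceP; split=> [|x y /= ex ey|a x /= _ ex].
- by rewrite /= lie0r.
- by rewrite lieBr ex ey subr0.
- by rewrite lieZr ex scaler0.
Qed.

Lemma not_annihilates_degree1 u :
  ~ (forall x, Mg 1%N x -> lie u x = 0) -> exists2 x, L1 x & lie u x != 0.
Proof.
move=> nu; apply: contrapT => nox; apply/nu/annihilates_degree1 => x Lx.
by apply/eqP; apply: contra_notT nox => ux; exists x.
Qed.

Lemma ideal_homog_subspace (I : set M) i : is_subspace F I -> (1 <= i)%N ->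
  is_subspace F (I `&` L i).
Proof.
move=> hI i1; have hL := lie_comp_subspace i1; apply/is_subspaceP; split.
- by split; [apply: (subspace0 hI) | apply: (subspace0 hL)].
- move=> x y [Ix Lx] [Iy Ly].
  by split; [apply: (subspaceB hI) | apply: (subspaceB hL)].
- move=> a x Fa [Ix Lx].
  by split; [apply: (subspaceZ hI) | apply: (subspaceZ hL)].
Qed.

(** The map used by the definition of the [i]-th two-step field. *)
Definition phi i : M -> E := xget (fun=> 0) (two_step_map Mg L1 i).

Lemma two_step_map_exists i : (2 <= i)%N -> exists p, two_step_map Mg L1 i p.
Proof.
move=> i2; have [e [Me e0 eP]] := homog_line hM i2.
have [f [_ f0 fP]] := homog_line hM (leqW i2).
pose psi x := xget 0 [set a | lie e x = a *: f].
have psiE x : Mg 1%N x -> lie e x = psi x *: f.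
  move=> Mx; have [a ha] := fP _ (homog_lie1 hM (ltnW i2) Me Mx).
  exact: (@xgetPex _ 0 [set a | lie e x = a *: f] (ex_intro _ a ha)).
have [l Ll l0] : exists2 l, L1 l & lie e l != 0.
  apply: not_annihilates_degree1 => e_central.
  apply: (@homog_lie_neq0 _ _ _ hM i (ltnW i2)) => u x /eP[a ->] /e_central ex.
  by rewrite lieZl ex scaler0.
have psil : psi l != 0.
  by apply: contraNneq l0; rewrite (psiE l (hL1M Ll)) => ->; rewrite scale0r.
exists (fun x => psi x / psi l); split.
- move=> a x y Mx My; rewrite mulrA -mulrDl; congr (_ / _).
  have Maxy : Mg 1%N (a *: x + y).
    by apply: (subspaceD (homog_subspace hM _)) => //; apply: (homogZ hM).
  have := psiE _ Maxy.
  rewrite lieDr lieZr !psiE // scalerA -scalerDl => /eqP.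
  by rewrite -subr_eq0 -scalerBl scaler_eq0 (negPf f0) orbF subr_eq0 => /eqP.
- apply/seteqP; split=> x /= [Mx cx]; split=> //.
    have /eqP := cx e Me; rewrite psiE // scaler_eq0 (negPf f0) orbF => /eqP->.
    by rewrite mul0r.
  move=> u /eP[a ->]; rewrite lieZl psiE //.
  move/eqP: cx; rewrite mulf_eq0 invr_eq0 (negPf psil) orbF => /eqP->.
  by rewrite scale0r scaler0.
- by exists l => //=; rewrite divff.
Qed.

Lemma phiP i : (2 <= i)%N -> two_step_map Mg L1 i (phi i).
Proof. by move=> /two_step_map_exists/xgetPex; apply. Qed.

(** The definition of [phi i] mentions [i] only through its centraliser. *)
Lemma eq_phi i j : centraliser Mg i = centraliser Mg j -> phi i = phi j.
Proof. by rewrite /phi /two_step_map => ->. Qed.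

Lemma lie_phi i l : (2 <= i)%N -> L1 l -> phi i l = 1 ->
  forall u x, Mg i u -> Mg 1%N x -> lie u x = phi i x *: lie u l.
Proof.
move=> i2 Ll l1 u x Mu Mx; have [plin pker _] := phiP i2.
have Ml := hL1M Ll.
have [_ ker] : centraliser Mg i (- phi i x *: l + x).
  rewrite pker; split=> /=; last by rewrite plin // l1 mulr1 addNr.
  by apply: (subspaceD (homog_subspace hM _)) => //; apply: (homogZ hM).
have /eqP := ker u Mu; rewrite lieDr lieZr scaleNr addrC subr_eq0.
by move/eqP.
Qed.

Lemma phi_image_subspace i : (2 <= i)%N ->
  is_subspace F (phi i @` L1 : set E^o).
Proof.
move=> i2; have [plin _ _] := phiP i2.
have phi0 : phi i 0 = 0.
  have M0 := subspace0 (homog_subspace hM (ltn0Sn 0)).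
  have /eqP := plin 1 0 0 M0 M0.
  by rewrite mul1r scaler0 addr0 -subr_eq0 opprD addNKr oppr_eq0 => /eqP.
apply/is_subspaceP; split.
- by exists 0 => //; apply: (subspace0 hL1).
- move=> _ _ [x Lx <-] [y Ly <-]; exists (x - y); first exact: (subspaceB hL1).
  have -> : x - y = (-1) *: y + x by rewrite scaleN1r addrC.
  by rewrite plin ?mulN1r 1?addrC //; apply: hL1M.
- move=> a _ Fa [x Lx <-]; exists (a *: x); first exact: (subspaceZ hL1).
  rewrite -[a *: x]addr0 plin ?phi0 ?addr0 //; first exact: hL1M.
  exact: (subspace0 (homog_subspace hM _)).
Qed.

Lemma two_step_fieldE :
  K = subfield_gen (\bigcup_(i in [set i | (2 <= i)%N]) (phi i @` L1)).
Proof.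
apply/seteqP; split; apply: smallest_sub; try exact: subfield_gen_subfield.
  move=> a [i i2]; apply: smallest_sub; first exact: subfield_gen_subfield.
  by move=> b Vb; apply: sub_gen_smallest; exists i.
move=> a [i i2 Va]; apply: sub_gen_smallest; exists i => //.
exact: sub_gen_smallest.
Qed.

Lemma phi_two_step_field i x : (2 <= i)%N -> L1 x -> K (phi i x).
Proof.
move=> i2 Lx; rewrite two_step_fieldE; apply: sub_gen_smallest.
by exists i => //; exists x.
Qed.

Lemma phi_recurs j : (2 <= j)%N -> exists g, forall n, (2 <= n)%N ->
  exists2 m, (n <= m < n + g)%N & phi m @` L1 = phi j @` L1.
Proof.
move=> /(centraliser_recurs hM)[g hg]; exists g => n /hg[m mn cm].
by exists m => //; rewrite (eq_phi cm).
Qed.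

(** Generators [e i] of the components of [M] adapted to the maps [phi i]:
    [[e i, x] = phi i x e i.+1].  In these coordinates each component of [L] is
    an [F]-subspace of [E], and bracketing with [L1] multiplies it by
    [phi i (L1)]. *)
Lemma adapted_generators e2 : Mg 2 e2 -> e2 != 0 -> exists e : nat -> M,
  [/\ e 2%N = e2, forall i, (2 <= i)%N -> Mg i (e i) /\ e i != 0,
      forall i x, (2 <= i)%N -> Mg 1%N x -> lie (e i) x = phi i x *: e i.+1
    & forall i, (2 <= i)%N -> exists2 l, L1 l & lie (e i) l = e i.+1].
Proof.
move=> Me2 e20.
have exl i : exists l, (2 <= i)%N -> L1 l /\ phi i l = 1.
  have [i2|] := leqP 2 i; last by exists 0.
  by have [_ _ [l Ll l1]] := phiP i2; exists l.
have [l hl] := choice exl.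
pose e i := iteri (i - 2) (fun k u => lie u (l (k + 2)%N)) e2.
have eS i : (2 <= i)%N -> e i.+1 = lie (e i) (l i).
  by move=> i2; rewrite /e subSn //= subnK.
have elie i x : (2 <= i)%N -> Mg i (e i) -> Mg 1%N x ->
    lie (e i) x = phi i x *: e i.+1.
  by move=> i2 Me Mx; have [Ll l1] := hl i i2; rewrite eS //; apply: lie_phi.
have he i : (2 <= i)%N -> Mg i (e i) /\ e i != 0.
  elim: i => // i IH; rewrite leq_eqVlt => /orP[/eqP <-|i2]; first by split.
  have [Me e0] := IH i2; have [Ll _] := hl i i2; rewrite {1}eS //; split.
    by apply: (homog_lie1 hM) => //; [apply: ltnW | apply: hL1M].
  apply/negP => /eqP eS0.
  apply: (@homog_lie_neq0 _ _ _ hM i (ltnW i2)) => u x.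
  move=> /(homog_spanned hM i2 Me e0)[a ->] Mx.
  by rewrite lieZl elie // eS0 !scaler0.
exists e; split=> // [i x i2 Mx|i i2].
  by apply: elie => //; case: (he i i2).
by exists (l i); [case: (hl i i2) | rewrite eS].
Qed.

Section FiniteTwoStepField.
Hypothesis hK : finite_extension F K.

Let K_subfield : is_subfield K.
Proof. exact: subfield_gen_subfield. Qed.

(** A non-zero homogeneous element of degree [i >= 2] generates, under brackets
    with [L1], whole [K]-lines from degree [i + r] on, with [r] independent of
    the element. *)
Lemma brackets_fill_lines : exists2 r, (0 < r)%N &
  forall (e : nat -> M) (J : nat -> set M) i b,
    (forall k x, (2 <= k)%N -> Mg 1%N x -> lie (e k) x = phi k x *: e k.+1) ->
    (2 <= i)%N ->
    (forall k, (2 <= k)%N -> is_subspace F (J k)) ->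
    (forall k u x, (2 <= k)%N -> J k u -> L1 x -> J k.+1 (lie u x)) ->
    J i (b *: e i) ->
    forall j a, (i + r <= j)%N -> K a -> J j ((a * b) *: e j).
Proof.
have V1 k : (2 <= k)%N -> (phi k @` L1) 1 by move=> /phiP[].
have [r hr] := window_prod_eventually_full hF hK phi_image_subspace V1
  two_step_fieldE phi_recurs.
exists r.+1 => // e J i b elie i2 hJ Jlie Jb j a ij Ka.
have prodJ s c : window_prod F (fun k => phi k @` L1) i s c ->
    J (i + s)%N ((c * b) *: e (i + s)%N).
  elim: s c => [|s IH] c.
    by rewrite addn0 => Fc; rewrite -scalerA; apply: (subspaceZ (hJ i i2)).
  have is2 : (2 <= i + s)%N by apply: leq_trans i2 (leq_addr _ _).
  have hJs := hJ _ (leqW is2); rewrite addnS.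
  apply: (@kspan_sub _ F E^o _
    [set c | J (i + s).+1 ((c * b) *: e (i + s).+1)]).
    apply/is_subspaceP; split=> [|x y /= Jx Jy|d x /= Fd Jx].
    - by rewrite /= mul0r scale0r; apply: (subspace0 hJs).
    - by rewrite mulrBl scalerBl; apply: (subspaceB hJs).
    - by rewrite -[d *: x * b]mulrA -scalerA; apply: (subspaceZ hJs).
  move=> _ [x [_ [Sx [l Ll <-] ->]]] /=.
  rewrite mulrAC -scalerA -elie //; last exact: hL1M.
  by rewrite -lieZl; apply: Jlie => //; apply: IH.
have ji : (i + (j - i))%N = j by lia.
rewrite -ji; apply: prodJ.
have rji : (r <= j - i)%N by lia.
exact: (window_prod_mono V1 i2 rji (hr i i2 a Ka)).
Qed.

(** * Ideals in the two cases *)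

(** Every [L i] with [i >= 2] lies in the [K]-line of [e i] here, so a non-zero
    element of degree [i] of an ideal absorbs all of [L] from degree [i + r] on.
    In degree 1 one bracket leads to a non-zero element of degree 2, whence the
    constant [r + 1]. *)
Lemma ideally_constrained_dim2 : has_dim K (kspan K L1) 2 ->
  exists r : nat, (0 < r)%N /\ ideally_constrained F L r.
Proof.
move=> [v _ Wv]; pose v0 := v ord0; pose v1 := v ord_max.
have L1v x : L1 x -> exists a b, [/\ K a, K b & x = a *: v0 + b *: v1].
  move=> /(@sub_kspan _ K); rewrite Wv => /(kspan_rangeP _ _ K_subfield)[c Kc ->].
  exists (c ord0), (c ord_max); split=> //; rewrite big_ord_recl big_ord1.
  by congr (_ + c _ *: v _); apply/val_inj.
have Mv i : Mg 1%N (v i).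
  have : kspan K L1 `<=` Mg 1%N.
    apply: kspan_sub hL1M; have [hz hs] := homog_subspace hM (leqnn 1).
    by split=> // a x _; apply: hs.
  by apply; rewrite Wv; apply: sub_kspan; exists i.
have Mspan x : Mg 1%N x -> exists a b, x = a *: v0 + b *: v1.
  apply: (degree1_ind (W := [set x | exists a b, x = a *: v0 + b *: v1])) => [|y].
    apply/is_subspaceP; split.
    - by exists 0, 0; rewrite !scale0r addr0.
    - move=> _ _ [a [b ->]] [c [d ->]]; exists (a - c), (b - d).
      by rewrite !scalerBl opprD addrACA.
    - move=> c _ _ [a [b ->]]; exists (c * a), (c * b).
      by rewrite scalerDr !scalerA.
  by move=> /L1v[a [b [_ _ ->]]]; exists a, b.
have v01 := spanning_lie_neq0 hM Mspan.
have Mv01 := homog_lie1 hM (leqnn 1) (Mv ord0) (Mv ord_max).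
have [e [e2 he elie _]] := adapted_generators Mv01 v01.
have LK i : (2 <= i)%N -> L i `<=` [set u | exists2 a, K a & u = a *: e i].
  have lineB k x y : (exists2 a, K a & x = a *: e k) ->
      (exists2 a, K a & y = a *: e k) -> exists2 a, K a & x - y = a *: e k.
    move=> [a Ka ->] [b Kb ->]; exists (a - b); last by rewrite scalerBl.
    exact: (subfieldB K_subfield).
  have line0 k : exists2 a, K a & 0 = a *: e k.
    by exists 0; [apply: (subfield0 K_subfield) | rewrite scale0r].
  elim: i => // -[|[|i]] IH // _; apply: lie_set_min.
  - by apply/zmod_closedP; split=> [|x y]; [apply: line0 | apply: lineB].
  - move=> _ _ /L1v[a [b [Ka Kb ->]]] /L1v[c [d [Kc Kd ->]]].
    rewrite /= lie_det e2; exists (a * d - b * c) => //.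
    by apply: (subfieldB K_subfield); apply: (subfieldM K_subfield).
  - by apply/zmod_closedP; split=> [|x y]; [apply: line0 | apply: lineB].
  - move=> u x /IH[//|a Ka ->] Lx; exists (a * phi i.+2 x).
      by apply: (subfieldM K_subfield) => //; apply: phi_two_step_field.
    by rewrite lieZl elie // ?scalerA //; apply: hL1M.
have [r r0 fill] := brackets_fill_lines.
exists r.+1; split=> // I [hI Isub Ilie Itail] I0.
have Ibracket u x : I u -> L1 x -> I (lie u x).
  move=> Iu Lx; apply: Ilie; apply: mem_lie_set => //.
  by exact: (mem_tail (@lie_comp_subspace) (leqnn 1) Lx).
pose P i := `[< (1 <= i)%N /\ exists2 u, (I `&` L i) u & u != 0 >].
have exP : exists i, P i.
  apply: contrapT => noP; apply: I0; apply/seteqP; split=> u; last first.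
    by move=> ->; apply: (subspace0 hI).
  rewrite Itail => -[n [f [Jf ->]]]; rewrite big_nat_cond big1 // => i.
  move=> /andP[/andP[i1 _] _]; apply/eqP; apply: contra_notT noP => fi0.
  by exists i; apply/asboolP; split=> //; exists (f i) => //; apply: Jf.
case: (ex_minnP exP) => i /asboolP[i1 [u [Iu Lu] u0]] imin.
have below f k : (forall k, (1 <= k)%N -> (I `&` L k) (f k)) ->
    (1 <= k)%N -> (k < i)%N -> f k = 0.
  move=> Jf k1 ki; apply/eqP; apply: contraLR ki => fk0; rewrite -leqNgt.
  by apply: imin; apply/asboolP; split=> //; exists (f k) => //; apply: Jf.
exists i; split=> // [x|].
  rewrite {1}Itail => -[n [f [Jf ->]]]; exists n, f; split.
    by move=> k ik; have [] := Jf k (leq_trans i1 ik).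
  have [ni|ni] := leqP i n; last first.
    rewrite [RHS]big_geq; last exact: ltnW.
    rewrite big_nat_cond big1 // => k /andP[/andP[k1 kn] _].
    by rewrite below // (ltn_trans kn).
  rewrite (big_cat_nat i1 ni) /= big_nat_cond big1 ?add0r // => k.
  by move=> /andP[/andP[k1 ki] _]; rewrite below.
have absorb j w : (2 <= j)%N -> I w -> L j w -> w != 0 -> tail L (j + r) `<=` I.
  move=> j2 Iw Lw w0; have [b Kb wb] := LK j j2 w Lw.
  have b0 : b != 0 by apply: contraNneq w0 => b0; rewrite wb b0 scale0r.
  apply: (tail_min hI) => k jk x; have k2 : (2 <= k)%N by lia.
  move=> /(LK k k2)[a Ka ->].
  have [||||//] := fill e (fun k => I `&` L k) j b elie j2 _ _ _ k (a / b) jk.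
  - by move=> m m2; apply/ideal_homog_subspace/ltnW.
  - move=> m z t m2 [Iz Lz] Lt; split; first exact: Ibracket.
    by apply: lie_compS => //; apply: ltnW.
  - by rewrite /= -wb.
  - exact: (subfield_div K_subfield).
  - by rewrite divfK.
move: i1; rewrite leq_eqVlt => /orP[/eqP i1|i2]; last first.
  apply: subset_trans (absorb i u i2 Iu Lu u0).
  apply: (@tail_min _ F); first by apply: tail_subspace => k ik; apply: lie_comp_subspace; lia.
  by move=> k ik x; apply: mem_tail; [move=> m jm; apply: lie_comp_subspace; lia|lia].
subst i.
have [x Lx ux0] : exists2 x, L1 x & lie u x != 0.
  apply: not_annihilates_degree1 => u_central.
  have [x /u_central ux] := degree1_noncentral hM (hL1M Lu) u0.
  by rewrite ux eqxx.
rewrite -[(1 + r.+1)%N]/(2 + r)%N.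
apply: (absorb 2 (lie u x)) => //; first exact: Ibracket.
by apply: (@lie_compS 1).
Qed.

(** Two elements [x], [y] of [L1] give the coordinate [e 2 = [x, y]].  If every
    element of [L 2] were a [K]-multiple of [e 2], Cramer's rule would give
    [L1] inside [K x + K y].  So each [L i] contains [b e i] for some fixed [b]
    outside [K], while it contains [K e i] for large [i]: these lines form an
    ideal that misses [b e i] in all degrees. *)
Lemma not_just_infinite_dim_gt2 :
  (forall x y, L1 x -> L1 y -> ~ (L1 `<=` [set z | exists a b,
      [/\ K a, K b & z = a *: x + b *: y]])) ->
  ~ just_infinite F L.
Proof.
move=> notdim2.
have [x [y [Lx Ly xy0]]] : exists x y, [/\ L1 x, L1 y & lie x y != 0].
  apply: contrapT => noxy.
  have central x : L1 x -> forall y, Mg 1%N y -> lie x y = 0.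
    move=> Lx; apply: annihilates_degree1 => y Ly.
    by apply/eqP; apply: contra_notT noxy => xy; exists x, y.
  apply: (@homog_lie_neq0 _ _ _ hM 1) => // x y Mx My.
  rewrite lieC; apply/eqP; rewrite oppr_eq0; apply/eqP; move: x Mx.
  by apply: annihilates_degree1 => z Lz; rewrite lieC central ?oppr0.
have [Mx My] := (hL1M Lx, hL1M Ly).
have Mxy : Mg 2 (lie x y) by apply: (homog_lie1 hM).
have xyspan := lie_neq0_spanning hM Mx My xy0.
have [e [e2 he elie step]] := adapted_generators Mxy xy0.
have [b Lb nKb] : exists2 b, L 2 (b *: e 2%N) & ~ K b.
  apply: contrapT => nob; apply: (notdim2 x y Lx Ly) => z Lz /=.
  have [a [b zab]] := xyspan z (hL1M Lz).
  exists a, b; split=> //; apply: contrapT => nK; apply: nob.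
    exists a => //; rewrite e2.
    have -> : a *: lie x y = lie z y.
      by rewrite zab lieDl !lieZl liexx scaler0 addr0.
    exact: mem_lie_set.
  exists b => //; rewrite e2.
  have -> : b *: lie x y = lie x z.
    by rewrite zab lieDr !lieZr liexx scaler0 add0r.
  exact: mem_lie_set.
have Lbi i : (2 <= i)%N -> L i (b *: e i).
  elim: i => // i IH; rewrite leq_eqVlt => /orP[/eqP <- //|i2].
  have [l Ll <-] := step i i2; rewrite -lieZl; apply: lie_compS => //.
    exact: ltnW.
  exact: IH.
have [r r0 fill] := brackets_fill_lines.
pose N := (2 + r)%N.
pose line i : set M := [set u | exists2 a, K a & u = a *: e i].
have lineL i : (N <= i)%N -> line i `<=` L i.
  move=> Ni _ [a Ka ->].
  rewrite -[a]mulr1; apply: (fill e L 2%N 1) => //.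
  - by move=> k k2; apply/lie_comp_subspace/ltnW.
  - by move=> k u z k2; apply/lie_compS/ltnW.
  - by rewrite scale1r e2; apply: mem_lie_set.
have line_subspace i : is_subspace F (line i).
  apply/is_subspaceP; split.
  - by exists 0; [apply: (subfield0 K_subfield) | rewrite scale0r].
  - move=> _ _ [a Ka ->] [c Kc ->]; exists (a - c); last by rewrite scalerBl.
    exact: (subfieldB K_subfield).
  - move=> a _ Fa [c Kc ->]; exists (a * c); last by rewrite scalerA.
    by apply: (subfieldM K_subfield) => //; case: hK => FK _; apply: FK.
have line_lie1 i u z : (2 <= i)%N -> line i u -> L1 z -> line i.+1 (lie u z).
  move=> i2 [a Ka ->] Lz; exists (a * phi i z).
    by apply: (subfieldM K_subfield) => //; apply: phi_two_step_field.
  by rewrite lieZl elie ?scalerA //; apply: hL1M.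
have line_lie j i u z : (1 <= j)%N -> (2 <= i)%N -> line i u -> L j z ->
    line (i + j)%N (lie u z).
  elim: j i u z => // -[|j] IH i u z _ i2 lu.
    by rewrite addn1; apply: line_lie1.
  apply: (lie_set_min (W := [set z | line (i + j.+2)%N (lie u z)])).
    have hl := line_subspace (i + j.+2)%N.
    apply/zmod_closedP; split=> [|w t /= hw ht].
      by rewrite /= lie0r; apply: (subspace0 hl).
    by rewrite lieBr; apply: (subspaceB hl).
  move=> w t Lw Lt /=.
  have -> : lie u (lie w t) = lie (lie u w) t - lie (lie u t) w.
    by rewrite (lie_leibniz u w t) addrAC subrr add0r.
  rewrite addnS; apply: (subspaceB (line_subspace _)).
    by apply: line_lie1 => //; [lia | apply: IH].
  by rewrite -addSn; apply: IH => //; [lia | apply: line_lie1].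
pose I := tail line N.
have hI : is_subspace F I by apply: tail_subspace => i _.
have lineI i : (N <= i)%N -> line i `<=` I.
  by move=> Ni u; apply: mem_tail.
have hIL i (i1 : (1 <= i)%N) := ideal_homog_subspace hI i1.
have Itail : I = tail (fun i => I `&` L i) 1.
  apply/seteqP; split; last by apply: (tail_min hI) => i _ u [].
  apply: (tail_min (tail_subspace hIL)) => i Ni u lu.
  by apply: (mem_tail hIL (i := i)); [lia | split; [apply: lineI lu | apply: lineL]].
have Iideal : graded_ideal F L I.
  split=> //.
    apply: (tail_min (tail_subspace (@lie_comp_subspace))) => i Ni u lu.
    by apply: (mem_tail (@lie_comp_subspace) (i := i)); [lia | apply: lineL].
  apply: lie_set_min => [|u z Iu Lz]; first by case: hI.
  have closel w : is_subspace F [set t | I (lie t w)].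
    apply/is_subspaceP; split=> [|t s /= It Is|a t Fa /= It].
    - by rewrite /= lie0l; apply: (subspace0 hI).
    - by rewrite lieBl; apply: (subspaceB hI).
    - by rewrite lieZl; apply: (subspaceZ hI).
  have closer w : is_subspace F [set t | I (lie w t)].
    apply/is_subspaceP; split=> [|t s /= It Is|a t Fa /= It].
    - by rewrite /= lie0r; apply: (subspace0 hI).
    - by rewrite lieBr; apply: (subspaceB hI).
    - by rewrite lieZr; apply: (subspaceZ hI).
  apply: (tail_min (closel z) _ Iu) => i Ni t lt.
  apply: (tail_min (closer t) _ Lz) => j j1 s Ls.
  by apply: (lineI (i + j)%N); [lia | apply: line_lie => //; lia].
have Inz : I <> [set 0].
  have [_ eN] := he N (leq_addr _ _).
  have : I (e N).
    by apply: (lineI N) => //; exists 1; [apply: subfield1 | rewrite scale1r].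
  by move=> IN I0; rewrite I0 /= in IN; rewrite IN eqxx in eN.
move=> [_ /(_ I Iideal Inz)[n [v [vL Lspan]]]].
(* in a degree m beyond all the chosen vectors, the span of the ideal and of
   these vectors has its component in K (e m) *)
have vsum i : exists s, exists2 f : nat -> M,
    forall k, (1 <= k)%N -> L k (f k) & v i = \sum_(1 <= k < s) f k.
  by have [s [f [Lf vf]]] := vL i; exists s, f.
have [d hd] := choice vsum.
pose m := maxn 2 (\max_i d i).
have m2 : (2 <= m)%N by apply: leq_maxl.
pose A k := if k == m then line m else Mg k.
have hA k : (1 <= k)%N -> is_subspace F (A k).
  move=> k1; rewrite /A; case: eqP => _ //.
  have hk := homog_subspace hM k1; split; first by case: hk.
  by move=> a u _; apply: (subspaceZ hk).
have A0 k : (1 <= k)%N -> A k 0 by move=> k1; apply: (subspace0 (hA k k1)).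
have lineA k : (2 <= k)%N -> line k `<=` A k.
  move=> k2; rewrite /A; case: eqP => [->//|_] _ [a _ ->].
  by apply: (homogZ hM); [lia | case: (he k k2)].
have : L m (b *: e m) by apply: Lbi.
move=> /(mem_tail (@lie_comp_subspace) (ltnW m2)).
rewrite Lspan => /(kspan_sub (W := tail A 1) (tail_subspace hA)) Atail.
have {Atail} [s [f [Af bef]]] : tail A 1 (b *: e m).
  apply: Atail => w [Iw|[i _ <-]].
    apply: (tail_min (tail_subspace hA) _ Iw) => k Nk t /lineA lt.
    by apply: (mem_tail hA (i := k)); [lia | apply: lt; lia].
  have [g Lg ->] := hd i; exists m, (fun k => if (k < d i)%N then g k else 0).
  have dm : (d i <= m)%N.
    by rewrite (leq_trans _ (leq_maxr _ _)) // leq_bigmax.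
  split; last by rewrite (big_nat_widen _ _ _ _ _ dm) big_mkcond.
  move=> k k1; case: ltnP => [kd|_]; last exact: A0.
  by rewrite /A ltn_eqF; [apply: lie_comp_sub => //; apply: Lg | lia].
have [g Ag beg] := tail_extend A0 Af bef (leq_maxl s m.+1).
have [_ direct] : tail Mg 1 = setT /\ direct Mg by case: hM.
pose h k := g k - (if k == m then b *: e m else 0).
have Mh k : (1 <= k)%N -> Mg k (h k).
  move=> k1; have hk := homog_subspace hM k1.
  have := Ag k k1; rewrite /A /h; case: eqP => [->|_] gk; last by rewrite subr0.
  have [Mem _] := he m m2; have hm := homog_subspace hM (ltnW m2).
  apply: (subspaceB hm); last by apply: (subspaceZ hm).
  by case: gk => a _ ->; apply: (subspaceZ hm).
have h0 : \sum_(1 <= k < maxn s m.+1) h k = 0.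
  rewrite sumrB -beg [X in _ - X](_ : _ = b *: e m) ?subrr //.
  by rewrite -big_mkcond big_nat1_eq ltnW // leq_max ltnSn orbT.
have /eqP : h m = 0 by apply: (direct _ h Mh h0); lia.
rewrite /h eqxx subr_eq0 => /eqP gm.
have := Ag m (ltnW m2); rewrite /A eqxx gm => -[a Ka /eqP].
have [_ em0] := he m m2.
rewrite -subr_eq0 -scalerBl scaler_eq0 (negPf em0) orbF subr_eq0 => /eqP ba.
by apply: nKb; rewrite ba.
Qed.

End FiniteTwoStepField.
End Generated.

Theorem theorem15 (E : fieldType) (F : set E) (M : lieAlgType E)
    (Mg : nat -> set M) (L1 : set M)
    (hF : is_subfield F)
    (hM : maximal_class Mg)
    (hL1 : is_subspace F L1)
    (hL1fin : fin_dim F L1)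
    (hL1M : L1 `<=` Mg 1%N)
    (hEL1 : kspan setT L1 = Mg 1%N)
    (hK : finite_extension F (two_step_field Mg L1)) :
  (has_dim (two_step_field Mg L1) (kspan (two_step_field Mg L1) L1) 2 /\
   exists r : nat, (0 < r)%N /\ ideally_constrained F (lie_comp L1) r)
  \/
  ((exists d : nat, (2 < d)%N /\
      has_dim (two_step_field Mg L1) (kspan (two_step_field Mg L1) L1) d) /\
   ~ just_infinite F (lie_comp L1)).
Proof.
have K_subfield : is_subfield (two_step_field Mg L1).
  exact: subfield_gen_subfield.
have [FK _] := hK; set K := two_step_field Mg L1 in K_subfield FK *.
have [n [u _ L1u]] := hL1fin.
have Ku : kspan K L1 = kspan K (range u).
  have hs := kspan_subspace K (range u).
  apply/seteqP; split; apply: kspan_sub; try exact: kspan_subspace.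
    rewrite L1u; apply: kspan_sub; last exact: sub_kspan.
    by case: hs => h0 hZ; split=> // a x /FK; apply: hZ.
  by move=> _ [i _ <-]; apply: sub_kspan; rewrite L1u; apply: sub_kspan; exists i.
have [d hd dmin] := minimal_basis K_subfield Ku.
have two (x y : M) : L1 x -> L1 y -> L1 `<=` [set z | exists a b,
    [/\ K a, K b & z = a *: x + b *: y]] -> (d <= 2)%N.
  move=> Lx Ly sub; pose v (i : 'I_2) := if i == ord0 then x else y.
  apply: (dmin 2%N v); apply/seteqP; split; last first.
    apply: kspan_sub; first exact: kspan_subspace.
    by move=> _ [i _ <-]; apply: sub_kspan; rewrite /v; case: eqP.
  apply: kspan_sub; first exact: kspan_subspace.
  move=> z /sub[a [b [Ka Kb ->]]]; apply/(kspan_rangeP _ _ K_subfield).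
  exists (fun i : 'I_2 => if i == ord0 then a else b); first by move=> i; case: eqP.
  by rewrite big_ord_recl big_ord1.
have [d2|d2] := ltnP 2 d.
  right; split; first by exists d.
  apply: (not_just_infinite_dim_gt2 hF hM) => // x y Lx Ly /(two x y Lx Ly).
  by rewrite leqNgt d2.
have {}d2 : d = 2%N.
  apply/eqP; rewrite eqn_leq d2 leqNgt; apply/negP => d1.
  case: hd => v _ Kv.
  (* a K-line cannot contain two elements with a non-zero bracket *)
  have [w L1w] : exists w, L1 `<=` [set z | exists a, z = a *: w].
    case: d d1 v Kv {d2 dmin two} => [|[|//]] _ v Kv.
      exists 0 => z /(@sub_kspan _ K); rewrite Kv.
      by move=> /(kspan_rangeP _ _ K_subfield)[c _ ->]; exists 0; rewrite big_ord0 scaler0.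
    exists (v ord0) => z /(@sub_kspan _ K); rewrite Kv.
    by move=> /(kspan_rangeP _ _ K_subfield)[c _ ->]; exists (c ord0); rewrite big_ord1.
  have Mw : Mg 1%N `<=` [set z | exists a, z = a *: w].
    rewrite -hEL1; apply: kspan_sub L1w; apply/is_subspaceP; split.
    - by exists 0; rewrite scale0r.
    - by move=> _ _ [a ->] [b ->]; exists (a - b); rewrite scalerBl.
    - by move=> a _ _ [b ->]; exists (a * b); rewrite scalerA.
  apply: (@homog_lie_neq0 _ _ _ hM 1) => // _ _ /Mw[a ->] /Mw[b ->].
  by rewrite lieZl lieZr liexx !scaler0.
left; rewrite d2 in hd; split=> //.
exact: (ideally_constrained_dim2 hF hM hL1 hL1M hEL1 hK hd).
Qed.
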